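(* Let $h\colon(0,\infty)\to\mathbb{R}$ be a monotone (nondecreasing) function, and put $\tilde h(x)=-h(x^{-1})$ for $x>0$. Suppose that $\tilde h$ is concave, that $\lim_{x\to 0}h(x)\,x=0$, and that the function $$\breve h(t)=\inf_{x>0}\bigl(tx-\tilde h(x)\bigr)=\inf_{x>0}\bigl(tx+h(x^{-1})\bigr)\qquad(t>0)$$ satisfies $$\breve h\Bigl(\frac{x+y}{2}\Bigr)\ \ge\ \frac{\breve h(x)+\breve h(y)}{2}\ \ge\ \breve h\Bigl(\frac{2}{x^{-1}+y^{-1}}\Bigr)\qquad\text{for all }x,y>0.$$ Let $f,g\colon(0,\infty)\to(0,\infty)$ be positive operator monotone decreasing functions, and let $\Phi\colon M_m(\mathbb{C})\to M_k(\mathbb{C})$ and $\Psi\colon M_n(\mathbb{C})\to M_k(\mathbb{C})$ be strictly positive linear maps. Then the map $$M_m(\mathbb{C})^{++}\times M_n(\mathbb{C})^{++}\to\mathbb{R},\qquad (A,B)\mapsto \operatorname{Tr} h\bigl(\Phi(f(A))^{1/2}\,\Psi(g(B))\,\Phi(f(A))^{1/2}\bigr)$$ is jointly convex.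
   Context: $M_n(\mathbb{C})^{++}$ denotes the set of positive invertible (positive definite) $n\times n$ complex matrices. A linear map $\Phi\colon M_m(\mathbb{C})\to M_k(\mathbb{C})$ is strictly positive if it sends $M_m(\mathbb{C})^{++}$ into $M_k(\mathbb{C})^{++}$. Functions of matrices are defined by functional calculus. A function $f\colon(0,\infty)\to\mathbb{R}$ is operator monotone if for every $n$ and all $A,B\in M_n(\mathbb{C})^{++}$, $A\le B$ implies $f(A)\le f(B)$; it is operator monotone decreasing if $A\le B$ implies $f(A)\ge f(B)$. Here $A \le B$ is the usual (Loewner) order: $B-A$ is positive semidefinite. Jointly convex means convex as a function of the pair $(A,B)$ on the convex set $M_m(\mathbb{C})^{++}\times M_n(\mathbb{C})^{++}$. $\operatorname{Tr}$ is the usual matrix trace. *)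

(* Defs.v *)
From HB Require Import structures.
From mathcomp Require Import all_boot all_order all_algebra spectral sesquilinear.
From mathcomp Require Import complex.
From mathcomp Require Import all_classical all_reals all_analysis.

Set Implicit Arguments.
Unset Strict Implicit.
Unset Printing Implicit Defensive.

Import Order.TTheory GRing.Theory Num.Theory.
Import numFieldNormedType.Exports.

Local Open Scope classical_set_scope.
Local Open Scope ring_scope.
Local Open Scope complex_scope.
Local Open Scope sesquilinear_scope.

(* Functions on (0, +oo) are represented by total functions R -> R; every
   hypothesis constrains them on positive arguments only. *)

Section Matrices.
Variable R : realType.

(* On R[i], 0 <= z means that z is real and nonnegative. *)
Definition possemidef n (A : 'M[R[i]]_n) : Prop :=
  A \is hermsymmx /\ forall v : 'cV[R[i]]_n, 0 <= (v^t* *m A *m v) 0 0.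

Definition posdef n (A : 'M[R[i]]_n) : Prop :=
  possemidef A /\ A \in unitmx.

Definition loewner_le n (A B : 'M[R[i]]_n) : Prop := possemidef (B - A).

(* Functional calculus, meaningful for Hermitian A: A = P^-1 D P with
   P := spectralmx A unitary and D diagonal with real entries, which is what
   makes taking the real part of the eigenvalues harmless. *)
Definition mxfun n (phi : R -> R) (A : 'M[R[i]]_n) : 'M[R[i]]_n :=
  invmx (spectralmx A)
  *m diag_mx (map_mx (fun z => (phi (complex.Re z))%:C) (spectral_diag A))
  *m spectralmx A.

Definition operator_monotone_decreasing (f : R -> R) : Prop :=
  forall n (A B : 'M[R[i]]_n), posdef A -> posdef B ->
    loewner_le A B -> loewner_le (mxfun f B) (mxfun f A).

Definition strictly_positive m k (Phi : 'M[R[i]]_m -> 'M[R[i]]_k) : Prop :=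
  forall A, posdef A -> posdef (Phi A).

Definition jointly_convex m n (F : 'M[R[i]]_m -> 'M[R[i]]_n -> R) : Prop :=
  forall (A1 A2 : 'M[R[i]]_m) (B1 B2 : 'M[R[i]]_n) (t : R),
    posdef A1 -> posdef A2 -> posdef B1 -> posdef B2 -> 0 <= t <= 1 ->
    F (t%:C *: A1 + (1 - t)%:C *: A2) (t%:C *: B1 + (1 - t)%:C *: B2)
      <= t * F A1 B1 + (1 - t) * F A2 B2.

(* h is applied to a Hermitian matrix, so the trace is a real number and
   complex.Re merely retypes it from R[i] to R. *)
Definition trace_function m n k (h f g : R -> R)
    (Phi : 'M[R[i]]_m -> 'M[R[i]]_k) (Psi : 'M[R[i]]_n -> 'M[R[i]]_k)
    (A : 'M[R[i]]_m) (B : 'M[R[i]]_n) : R :=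
  let S := mxfun Num.sqrt (Phi (mxfun f A)) in
  complex.Re (\tr (mxfun h (S *m Psi (mxfun g B) *m S))).

End Matrices.

Section Transforms.
Variable R : realType.

Definition concave_function (D : set R) (f : R -> R) : Prop :=
  convex_function (D : set (convex_lmodType R^o)) (fun x => - f x).

Definition tilde (h : R -> R) (x : R) : R := - h x^-1.

(* If tilde h is concave and nondecreasing on (0, +oo) and h x * x tends to 0
   at 0, then for t > 0 the set below is nonempty and bounded below, so that
   this real infimum is the genuine one. *)
Definition breve (h : R -> R) (t : R) : R :=
  inf [set t * x - tilde h x | x in [set x : R | 0 < x]].

End Transforms.

(* Main.v *)
(* Variational argument. Put X = Phi (f A), Y = Psi (g B), k s = breve h (1 / s)
   and Z = X^(1/2) Y X^(1/2). Legendre duality for h (1 / x) gives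
     Tr h(Z) = sup_W Tr breve h (X^(1/2) W X^(1/2)) - Tr (W Y^-1)
             = sup_W Tr k (W^(-1/2) X^-1 W^(-1/2)) - Tr (W Y^-1),
   the second line because the two matrices involved are inverse to each other
   up to similarity. The harmonic-mean hypothesis says that k is convex, and k is
   nonincreasing, so it is enough to know that X^-1 and Y^-1 are operator concave
   functions of A and B. For f this is a comparison of parallel sums: the block
   matrix trick turns operator monotonicity into
     f (t A + (1 - t) B) <= (f A / t) : (f B / (1 - t)),
   and a positive map satisfies Phi (P : Q) <= Phi P : Phi Q, as one sees after
   diagonalising P and Q simultaneously by congruence. A parallel sum P : Q is
   only used through its form, u |-> inf over u = a + b of P(a) + Q(b). *)

Require Import Defs.
From HB Require Import structures.
From mathcomp Require Import all_boot all_order all_algebra spectral sesquilinear.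
From mathcomp Require Import complex.
From mathcomp Require Import all_classical all_reals all_analysis.
From mathcomp Require Import ring lra.

Import Order.TTheory GRing.Theory Num.Theory.
Import numFieldNormedType.Exports.

Local Open Scope classical_set_scope.
Local Open Scope ring_scope.
Local Open Scope complex_scope.

Set Implicit Arguments.
Unset Strict Implicit.

(** * Adjoints, real-valued quadratic forms and functional calculus *)

Section QuadraticForms.
Local Open Scope sesquilinear_scope.
Context {R : realType}.
Local Notation C := R[i].

Lemma conjtrM m n p (A : 'M[C]_(m, n)) (B : 'M[C]_(n, p)) :
  (A *m B)^t* = B^t* *m A^t*.
Proof. by rewrite trmx_mul map_mxM. Qed.

Lemma conjtrD m n (A B : 'M[C]_(m, n)) : (A + B)^t* = A^t* + B^t*.
Proof. by rewrite linearD map_mxD. Qed.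

Lemma conjtrN m n (A : 'M[C]_(m, n)) : (- A)^t* = - A^t*.
Proof. by rewrite linearN map_mxN. Qed.

Lemma conjtrZ m n (s : R) (A : 'M[C]_(m, n)) : (s%:C *: A)^t* = s%:C *: A^t*.
Proof.
by apply/matrixP => i j; rewrite !mxE rmorphM; congr (_ * _); exact: conjc_real.
Qed.

Lemma conjtr1 n : (1%:M : 'M[C]_n)^t* = 1%:M.
Proof. by rewrite trmx1 map_mx1. Qed.

Lemma hermitianD n (A B : 'M[C]_n) :
  A^t* = A -> B^t* = B -> (A + B)^t* = A + B.
Proof. by move=> hA hB; rewrite conjtrD hA hB. Qed.

Lemma hermitianZ n (s : R) (A : 'M[C]_n) :
  A^t* = A -> (s%:C *: A)^t* = s%:C *: A.
Proof. by move=> hA; rewrite conjtrZ hA. Qed.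

Lemma hermmxE n (A : 'M[C]_n) : A \is hermsymmx <-> A^t* = A.
Proof.
split=> [/is_hermitianmxP|hA]; first by rewrite expr0 scale1r => {2}->.
by apply/is_hermitianmxP; rewrite expr0 scale1r hA.
Qed.


(** The real part makes forms comparable in [R]; for Hermitian [A] the value is already real, so
    nothing is lost. *)
Definition qform n (A : 'M[C]_n) (v : 'cV[C]_n) : R :=
  complex.Re ((v^t* *m A *m v) 0 0).

Lemma qformD n (A B : 'M[C]_n) v : qform (A + B) v = qform A v + qform B v.
Proof. by rewrite /qform mulmxDr mulmxDl mxE raddfD. Qed.

Lemma qformN n (A : 'M[C]_n) v : qform (- A) v = - qform A v.
Proof. by rewrite /qform mulmxN mulNmx mxE raddfN. Qed.

Lemma qformB n (A B : 'M[C]_n) v : qform (A - B) v = qform A v - qform B v.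
Proof. by rewrite qformD qformN. Qed.

Lemma ReZ (s : R) (z : C) : complex.Re (s%:C * z) = s * complex.Re z.
Proof. by case: z => a b /=; rewrite mul0r subr0. Qed.

Lemma qformZ n (s : R) (A : 'M[C]_n) v : qform (s%:C *: A) v = s * qform A v.
Proof. by rewrite /qform -scalemxAr -scalemxAl mxE ReZ. Qed.

Lemma qform_sum n (I : finType) (A : I -> 'M[C]_n) v :
  qform (\sum_i A i) v = \sum_i qform (A i) v.
Proof.
elim/big_rec2: _ => [|i x y _ <-]; last by rewrite qformD.
by rewrite /qform mulmx0 mul0mx mxE.
Qed.

Lemma qform_conj n p (A : 'M[C]_n) (Q : 'M[C]_(n, p)) v :
  qform (Q^t* *m A *m Q) v = qform A (Q *m v).
Proof. by rewrite /qform conjtrM !mulmxA. Qed.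

(** Real part of the sesquilinear form: bilinear over [R], so squares with real coefficients expand
    without conjugates. *)
Definition bform n (A : 'M[C]_n) (u v : 'cV[C]_n) : R :=
  complex.Re ((u^t* *m A *m v) 0 0).

Lemma bformDl n (A : 'M[C]_n) u v w :
  bform A (u + v) w = bform A u w + bform A v w.
Proof. by rewrite /bform conjtrD !mulmxDl mxE raddfD. Qed.

Lemma bformDr n (A : 'M[C]_n) u v w :
  bform A w (u + v) = bform A w u + bform A w v.
Proof. by rewrite /bform mulmxDr mxE raddfD. Qed.

Lemma bformZl n (A : 'M[C]_n) (s : R) u v :
  bform A (s%:C *: u) v = s * bform A u v.
Proof. by rewrite /bform conjtrZ -!scalemxAl mxE ReZ. Qed.

Lemma bformZr n (A : 'M[C]_n) (s : R) u v :
  bform A u (s%:C *: v) = s * bform A u v.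
Proof. by rewrite /bform -scalemxAr mxE ReZ. Qed.

Lemma qformE n (A : 'M[C]_n) u : qform A u = bform A u u.
Proof. by []. Qed.

Lemma qform_scalev n (A : 'M[C]_n) (s : R) v :
  qform A (s%:C *: v) = s ^+ 2 * qform A v.
Proof. by rewrite !qformE bformZl bformZr mulrA. Qed.

(* The defect in this convexity identity is what makes the parallel sum of two
   multiples of one form explicit. *)
Lemma qform_weighted n (A : 'M[C]_n) (s r : R) u v : s + r = 1 ->
  s * qform A u + r * qform A v - s * r * qform A (u + v)
    = qform A (s%:C *: u + (- r)%:C *: v).
Proof.
move=> sr; have -> : r = 1 - s by rewrite -sr addrAC subrr add0r.
rewrite !qformE !(bformDl, bformDr) !(bformZl, bformZr).
move: (bform A u u) (bform A u v) (bform A v u) (bform A v v) => a b c d.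
ring.
Qed.

Lemma possemidefE n (A : 'M[C]_n) :
  possemidef A <-> A^t* = A /\ forall v, 0 <= qform A v.
Proof.
split=> [[/hermmxE hA A0]|[hA A0]].
  by split=> // v; have := A0 v; rewrite lecE => /andP[].
split; first exact/hermmxE.
move=> v; rewrite lecE; apply/andP; split; last exact: A0.
(* A self-adjoint [1 x 1] matrix has a real entry. *)
have : (v^t* *m A *m v)^t* = v^t* *m A *m v.
  by rewrite !conjtrM trmxCK hA mulmxA.
move=> /matrixP/(_ 0 0); rewrite !mxE.
case: (\sum_j _) => a b [] bN; apply/eqP => /=; move: bN; lra.
Qed.

Lemma loewner_leP n (A B : 'M[C]_n) : loewner_le A B ->
  forall v, qform A v <= qform B v.
Proof. by move=> /possemidefE[_ AB] v; have := AB v; rewrite qformB subr_ge0. Qed.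

Definition rdiag n (d : 'I_n -> R) : 'M[C]_n := diag_mx (\row_i (d i)%:C).

Lemma rdiag_adj n (d : 'I_n -> R) : (rdiag d)^t* = rdiag d.
Proof.
rewrite tr_diag_mx map_diag_mx; congr diag_mx; apply/rowP => i.
by rewrite !mxE; exact: conjc_real.
Qed.

Lemma rdiagM n (d e : 'I_n -> R) :
  rdiag d *m rdiag e = rdiag (fun i => d i * e i).
Proof.
by rewrite mulmx_diag; congr diag_mx; apply/rowP => i; rewrite !mxE rmorphM.
Qed.

Lemma eq_rdiag n (d e : 'I_n -> R) : d =1 e -> rdiag d = rdiag e.
Proof. by move=> de; congr diag_mx; apply/rowP => i; rewrite !mxE de. Qed.

Lemma rdiag1 n : rdiag (fun=> 1) = 1%:M :> 'M[C]_n.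
Proof. by rewrite -diag_const_mx; congr diag_mx; apply/rowP => i; rewrite !mxE. Qed.

Definition normsq (z : C) : R := complex.Re z ^+ 2 + complex.Im z ^+ 2.

Lemma normsq_ge0 z : 0 <= normsq z.
Proof. by rewrite addr_ge0 ?sqr_ge0. Qed.

Lemma conj_mulE (z : C) : z^* * z = (normsq z)%:C.
Proof.
case: z => a b; rewrite /normsq; apply/eqP; rewrite eq_complex /=.
by apply/andP; split; apply/eqP; ring.
Qed.

Lemma qform_rdiag n (d : 'I_n -> R) v :
  qform (rdiag d) v = \sum_i d i * normsq (v i 0).
Proof.
rewrite /qform mxE raddf_sum; apply: eq_bigr => i _.
by rewrite mul_mx_diag !mxE mulrAC mulrC conj_mulE [LHS]ReZ.
Qed.

Lemma spectral_decomposition n (A : 'M[C]_n) : A^t* = A ->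
  exists P : 'M[C]_n, exists d : 'I_n -> R,
    [/\ P^t* *m P = 1%:M, P *m P^t* = 1%:M, A = P^t* *m rdiag d *m P &
        forall phi, mxfun phi A = P^t* *m rdiag (phi \o d) *m P].
Proof.
move=> /hermmxE hA; exists (spectralmx A).
exists (fun i => complex.Re (spectral_diag A 0 i)).
have Pu := spectral_unitarymx A; have Pi := invmx_unitary Pu.
have PP := unitarymxP Pu.
have rE (phi : R -> R) :
    diag_mx (map_mx (fun z => (phi (complex.Re z))%:C) (spectral_diag A)) =
    rdiag (phi \o (fun i => complex.Re (spectral_diag A 0 i))).
  by apply/matrixP => i j; rewrite !mxE.
have dE : diag_mx (spectral_diag A) =
    rdiag (fun i => complex.Re (spectral_diag A 0 i)).
  apply/matrixP => i j; rewrite !mxE RRe_real //.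
  exact: (mxOverP (hermitian_spectral_diag_real hA)).
split; [|exact: PP| |].
- by rewrite -Pi (mulVmx (spectral_unit A)).
- by rewrite -Pi -dE -(orthomx_spectralP (hermitian_normalmx hA)).
- by move=> phi; rewrite /mxfun Pi rE.
Qed.

(** Entrywise the hypothesis reads [(d i - e j) Q i j = 0]: wherever [Q i j] is nonzero,
    [d i = e j], hence [phi (d i) = phi (e j)]. *)
Lemma rdiag_intertwine n p (d : 'I_n -> R) (e : 'I_p -> R) (Q : 'M[C]_(n, p))
    (phi : R -> R) :
  rdiag d *m Q = Q *m rdiag e -> rdiag (phi \o d) *m Q = Q *m rdiag (phi \o e).
Proof.
move=> /matrixP dQ; apply/matrixP => i j; have := dQ i j.
rewrite !mul_diag_mx !mul_mx_diag !mxE /=.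
have [->|Q0] := eqVneq (Q i j) 0; first by rewrite !mulr0 !mul0r.
by rewrite mulrC => /(mulfI Q0) [->]; rewrite mulrC.
Qed.

(* The source of unitary covariance, of the action of [phi] on block matrices,
   and of the equality of traces for similar Hermitian matrices. *)
Lemma mxfun_intertwine n p (A : 'M[C]_n) (B : 'M[C]_p) (Q : 'M[C]_(n, p))
    (phi : R -> R) : A^t* = A -> B^t* = B ->
  A *m Q = Q *m B -> mxfun phi A *m Q = Q *m mxfun phi B.
Proof.
move=> /spectral_decomposition[P [d [P1 P2 AE fA]]].
move=> /spectral_decomposition[P' [e [P1' P2' BE fB]]].
rewrite fA fB AE BE => AQ.
(* Written in eigenbases of [A] and [B], the relation intertwines two diagonal matrices. *)
have /(rdiag_intertwine phi) :
    rdiag d *m (P *m Q *m P'^t*) = (P *m Q *m P'^t*) *m rdiag e.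
  have := congr1 (fun X => P *m X *m P'^t*) AQ.
  by rewrite /= !mulmxA P2 mul1mx -!mulmxA P2' mulmx1.
move=> /(congr1 (fun X => P^t* *m X *m P')).
by rewrite /= !mulmxA P1 mul1mx -!mulmxA P1' mulmx1.
Qed.

(** Functional calculus does not depend on the chosen diagonalisation: two unitary ones are linked
    by an intertwiner of their diagonals. *)
Lemma mxfun_rdiag n (A P : 'M[C]_n) (d : 'I_n -> R) (phi : R -> R) :
  P^t* *m P = 1%:M -> A = P^t* *m rdiag d *m P ->
  mxfun phi A = P^t* *m rdiag (phi \o d) *m P.
Proof.
move=> P1 AE; have P2 := mulmx1C P1.
have hA : A^t* = A by rewrite AE !conjtrM rdiag_adj trmxCK mulmxA.
have /spectral_decomposition[P' [e [P1' P2' AE' fA]]] := hA.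
have /(rdiag_intertwine phi) : rdiag e *m (P' *m P^t*) = (P' *m P^t*) *m rdiag d.
  have := congr1 (fun X => P' *m X *m P^t*) (etrans (esym AE') AE).
  by rewrite /= !mulmxA P2' mul1mx -!mulmxA P2 mulmx1.
rewrite fA => /(congr1 (fun X => P'^t* *m X *m P)).
by rewrite /= !mulmxA P1' mul1mx -!mulmxA P1 mulmx1.
Qed.

Lemma mxfun_id n (A : 'M[C]_n) : A^t* = A -> mxfun id A = A.
Proof. by move=> /spectral_decomposition[P [d [_ _ -> ->]]]. Qed.

Lemma mxfunM n (A : 'M[C]_n) (phi psi : R -> R) : A^t* = A ->
  mxfun phi A *m mxfun psi A = mxfun (fun x => phi x * psi x) A.
Proof.
move=> /spectral_decomposition[P [d [P1 P2 AE fA]]]; rewrite !fA.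
rewrite -!mulmxA (mulmxA P) P2 mul1mx (mulmxA (rdiag _)) rdiagM mulmxA.
reflexivity.
Qed.

Lemma tr_mxfun_similar n (A B Q : 'M[C]_n) (phi : R -> R) :
  A^t* = A -> B^t* = B -> Q \in unitmx -> A *m Q = Q *m B ->
  \tr (mxfun phi A) = \tr (mxfun phi B).
Proof.
move=> hA hB Qu /(mxfun_intertwine phi hA hB) /(congr1 (mulmx^~ (invmx Q))).
by rewrite (mulmxK Qu) => ->; rewrite mxtrace_mulC (mulKmx Qu).
Qed.
End QuadraticForms.

(** * Positive definite matrices, their inverses and square roots *)

Section PositiveDefinite.
Local Open Scope sesquilinear_scope.
Context {R : realType}.
Local Notation C := R[i].

Lemma normsq0 : normsq (0 : C) = 0.
Proof. by rewrite /normsq /= expr0n addr0. Qed.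

Lemma normsq1 : normsq (1 : C) = 1.
Proof. by rewrite /normsq /= expr0n expr1n addr0. Qed.

Lemma normsq_gt0 (z : C) : z != 0 -> 0 < normsq z.
Proof.
move=> z0; rewrite lt_neqAle normsq_ge0 andbT eq_sym.
apply: contra z0 => /eqP; case: z => a b; rewrite /normsq /= => ab.
have a0 : a = 0 by nra.
by rewrite a0 (_ : b = 0) //; nra.
Qed.

Lemma posdef_adj n (A : 'M[C]_n) : posdef A -> A^t* = A.
Proof. by case=> /possemidefE[]. Qed.

Lemma unitmx_rdiag n (d : 'I_n -> R) :
  rdiag d \in unitmx <-> forall i, d i != 0.
Proof.
rewrite unitmxE det_diag unitfE prodf_seq_neq0; split=> [/allP d0 i|d0].
  have := d0 i (mem_index_enum i); rewrite !mxE /=.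
  by apply: contra => /eqP ->.
apply/allP => i _; rewrite !mxE /=; apply: contra (d0 i).
by rewrite eq_complex /= => /andP[].
Qed.

Lemma posdef_spectral n (A : 'M[C]_n) : posdef A ->
  exists P : 'M[C]_n, exists d : 'I_n -> R,
    [/\ P^t* *m P = 1%:M, P *m P^t* = 1%:M, A = P^t* *m rdiag d *m P,
        forall phi, mxfun phi A = P^t* *m rdiag (phi \o d) *m P &
        forall i, 0 < d i].
Proof.
move=> [/possemidefE[hA A0] uA].
have [P [d [P1 P2 AE fA]]] := spectral_decomposition hA.
exists P, d; split; [exact: P1|exact: P2|exact: AE|exact: fA|move=> i].
have dE : rdiag d = P *m A *m P^t*.
  by rewrite AE !mulmxA P2 mul1mx -mulmxA P2 mulmx1.
have Pu : P \in unitmx by case: (mulmx1_unit P2).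
have Pu' : P^t* \in unitmx by case: (mulmx1_unit P2).
rewrite lt_neqAle eq_sym; apply/andP; split.
  have : rdiag d \in unitmx by rewrite dE !unitmx_mul Pu uA.
  by move=> /unitmx_rdiag; exact.
(* The form at the [i]-th eigenvector is [d i]. *)
have := A0 (P^t* *m delta_mx i 0); rewrite AE qform_conj mulmxA P2 mul1mx.
rewrite qform_rdiag (bigD1 i) //= big1 => [|j ji].
  by rewrite mxE !eqxx normsq1 mulr1 addr0.
by rewrite mxE (negbTE ji) normsq0 mulr0.
Qed.

Lemma posdefP n (A : 'M[C]_n) :
  posdef A <-> A^t* = A /\ forall v, v != 0 -> 0 < qform A v.
Proof.
split=> [pA|[hA A0]].
  split; first exact: posdef_adj.
  have [P [d [P1 P2 -> _ d0]]] := posdef_spectral pA.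
  move=> v v0; rewrite qform_conj qform_rdiag lt_neqAle.
  have s0 i : 0 <= d i * normsq ((P *m v) i 0).
    by rewrite mulr_ge0 ?normsq_ge0 // ltW.
  rewrite sumr_ge0 ?andbT // eq_sym; apply: contra v0.
  rewrite psumr_eq0 // => /allP Pv0.
  suff Pv : P *m v = 0 by rewrite -(mul1mx v) -P1 -mulmxA Pv mulmx0.
  apply/matrixP => i j; rewrite ord1 [RHS]mxE; apply/eqP.
  have := Pv0 i (mem_index_enum i); apply: contraTT => /normsq_gt0 Pvi.
  by rewrite gt_eqF // mulr_gt0.
split.
  apply/possemidefE; split; first exact: hA.
  move=> v; have [->|v0] := eqVneq v 0; last exact/ltW/A0.
  by rewrite /qform mulmx0 mxE.
(* If [A] were singular, the adjoint of a nonzero row vector killing it would annihilate the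
   form. *)
rewrite unitmxE unitfE; apply/negP => /det0P[v v0 vA].
have : 0 < qform A (v^t*).
  apply: A0; apply: contra v0 => /eqP v0.
  by rewrite -(trmxCK v) v0 trmx0 map_mx0.
by rewrite /qform trmxCK vA mul0mx mxE ltxx.
Qed.

Lemma posdef_ge0 n (A : 'M[C]_n) v : posdef A -> 0 <= qform A v.
Proof. by case=> /possemidefE[]. Qed.

Lemma posdefD n (A B : 'M[C]_n) : posdef A -> possemidef B -> posdef (A + B).
Proof.
move=> /posdefP[hA A0] /possemidefE[hB B0]; apply/posdefP.
split=> [|v v0]; first by rewrite conjtrD hA hB.
by rewrite qformD ltr_wpDr // A0.
Qed.

Lemma posdefZ n (s : R) (A : 'M[C]_n) : 0 < s -> posdef A -> posdef (s%:C *: A).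
Proof.
move=> s0 /posdefP[hA A0]; apply/posdefP.
split=> [|v v0]; first by rewrite conjtrZ hA.
by rewrite qformZ mulr_gt0 // A0.
Qed.

Lemma posdef_conj n (A Q : 'M[C]_n) :
  Q \in unitmx -> posdef A -> posdef (Q^t* *m A *m Q).
Proof.
move=> Qu /posdefP[hA A0]; apply/posdefP.
split=> [|v v0]; first by rewrite !conjtrM trmxCK hA mulmxA.
rewrite qform_conj A0 //; apply: contra v0 => /eqP Qv.
by rewrite -(mulKmx Qu v) Qv mulmx0.
Qed.

Lemma posdef1 n : posdef (1%:M : 'M[C]_n).
Proof.
apply/posdefP; split=> [|v v0]; first exact: conjtr1.
rewrite -rdiag1 qform_rdiag lt_neqAle.
have s0 i : 0 <= 1 * normsq (v i 0) by rewrite mul1r normsq_ge0.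
rewrite sumr_ge0 ?andbT // eq_sym; apply: contra v0.
rewrite psumr_eq0 // => /allP v0.
apply/eqP/matrixP => i j; rewrite ord1 [RHS]mxE; apply/eqP.
have := v0 i (mem_index_enum i); apply: contraTT => /normsq_gt0 vi.
by rewrite mul1r gt_eqF.
Qed.

Lemma posdef_mxfun n (A : 'M[C]_n) (phi : R -> R) :
  (forall x, 0 < x -> 0 < phi x) -> posdef A -> posdef (mxfun phi A).
Proof.
move=> phi0 /posdef_spectral[P [d [P1 P2 _ -> d0]]].
have Pu : P \in unitmx by case: (mulmx1_unit P2).
apply: posdef_conj Pu _; split.
  apply/possemidefE; split; first exact: rdiag_adj.
  by move=> v; rewrite qform_rdiag sumr_ge0 // => i _;
     rewrite mulr_ge0 ?normsq_ge0 // ltW //= phi0.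
by apply/unitmx_rdiag => i; rewrite gt_eqF //= phi0.
Qed.

Lemma eq_mxfun n (A : 'M[C]_n) (phi psi : R -> R) :
  (forall x, 0 < x -> phi x = psi x) -> posdef A -> mxfun phi A = mxfun psi A.
Proof.
move=> pp /posdef_spectral[P [d [_ _ _ fA d0]]]; rewrite !fA.
have -> : rdiag (phi \o d) = rdiag (psi \o d).
  by apply: eq_rdiag => i /=; rewrite pp.
reflexivity.
Qed.

Lemma mxfun_inv n (A : 'M[C]_n) : posdef A ->
  mxfun (fun x => x^-1) A = invmx A.
Proof.
move=> pA; have uA := pA.2; have hA := posdef_adj pA.
suff AV : A *m mxfun (fun x => x^-1) A = 1%:M.
  by rewrite -(mulKmx uA (mxfun _ A)) AV mulmx1.
have [P [d [P1 P2 AE fA d0]]] := posdef_spectral pA.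
rewrite fA {1}AE -!mulmxA (mulmxA P) P2 mul1mx (mulmxA (rdiag _)) rdiagM.
rewrite (@eq_rdiag _ _ _ (fun=> 1)) ?rdiag1 ?mul1mx // => i /=.
by rewrite divff // gt_eqF.
Qed.

Lemma posdef_inv n (A : 'M[C]_n) : posdef A -> posdef (invmx A).
Proof.
move=> pA; rewrite -(mxfun_inv pA); apply: posdef_mxfun pA => x.
by rewrite invr_gt0.
Qed.

Lemma mxfun_sqrtK n (A : 'M[C]_n) : posdef A ->
  mxfun Num.sqrt A *m mxfun Num.sqrt A = A.
Proof.
move=> pA; have hA := posdef_adj pA; rewrite (mxfunM _ _ hA).
rewrite -[RHS](mxfun_id hA); apply: eq_mxfun pA => x x0 /=.
by rewrite -expr2 sqr_sqrtr // ltW.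
Qed.

Lemma posdef_sqrt n (A : 'M[C]_n) : posdef A -> posdef (mxfun Num.sqrt A).
Proof. by apply: posdef_mxfun => x; rewrite sqrtr_gt0. Qed.

End PositiveDefinite.

(** * Operator monotone decreasing functions: from block matrices to parallel sums *)

Section OperatorMonotone.
Local Open Scope sesquilinear_scope.
Context {R : realType}.
Local Notation C := R[i].

Lemma bformDA n (A B : 'M[C]_n) u v :
  bform (A + B) u v = bform A u v + bform B u v.
Proof. by rewrite /bform mulmxDr mulmxDl mxE raddfD. Qed.

Lemma bformZA n (s : R) (A : 'M[C]_n) u v :
  bform (s%:C *: A) u v = s * bform A u v.
Proof. by rewrite /bform -scalemxAr -scalemxAl mxE ReZ. Qed.

Lemma bform_mulr n (A B : 'M[C]_n) u v : bform A u (B *m v) = bform (A *m B) u v.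
Proof. by rewrite /bform !mulmxA. Qed.

Lemma bform_mull n (A B : 'M[C]_n) u v :
  bform A (B *m u) v = bform (B^t* *m A) u v.
Proof. by rewrite /bform conjtrM !mulmxA. Qed.

Section OrthogonalBlocks.
Variables (m : nat) (K1 K2 : 'M[C]_(m + m, m)).
Hypotheses (K11 : K1^t* *m K1 = 1%:M) (K22 : K2^t* *m K2 = 1%:M).
Hypothesis K12 : K1^t* *m K2 = 0.

Let K21 : K2^t* *m K1 = 0.
Proof.
by have := congr1 (fun X => X^t*) K12; rewrite conjtrM trmxCK trmx0 map_mx0.
Qed.

Let KK : K1 *m K1^t* + K2 *m K2^t* = 1%:M.
Proof.
(* The square matrix with column blocks [K1] and [K2] is an isometry, so its left inverse is also a
   right inverse. *)
rewrite -mul_row_col; apply: mulmx1C.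
by rewrite mul_col_row K11 K12 K21 K22 -scalar_mx_block.
Qed.

(** Block-diagonal matrix relative to the ranges of the isometries [K1] and [K2]; the same notion
    then serves the standard and the rotated decomposition. *)
Definition blocks (A B : 'M[C]_m) := K1 *m A *m K1^t* + K2 *m B *m K2^t*.

Lemma qform_blocks A B v :
  qform (blocks A B) v = qform A (K1^t* *m v) + qform B (K2^t* *m v).
Proof. by rewrite qformD -!qform_conj !trmxCK. Qed.

Lemma blocks_adj A B : A^t* = A -> B^t* = B -> (blocks A B)^t* = blocks A B.
Proof. by move=> hA hB; rewrite conjtrD !conjtrM !trmxCK hA hB !mulmxA. Qed.

Lemma posdef_blocks A B : posdef A -> posdef B -> posdef (blocks A B).
Proof.
move=> pA pB; apply/posdefP; split.
  by apply: blocks_adj; exact: posdef_adj.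
have /posdefP[_ A0] := pA; have /posdefP[_ B0] := pB.
move=> v v0; rewrite qform_blocks.
have [Kv|Kv] := eqVneq (K1^t* *m v) 0.
  rewrite ltr_wpDl ?posdef_ge0 // B0 //; apply: contra v0 => /eqP Kv'.
  by rewrite -(mul1mx v) -KK mulmxDl -!mulmxA Kv Kv' !mulmx0 addr0.
by rewrite ltr_pwDl ?posdef_ge0 // A0.
Qed.

Lemma mxfun_blocks A B phi : A^t* = A -> B^t* = B ->
  mxfun phi (blocks A B) = blocks (mxfun phi A) (mxfun phi B).
Proof.
move=> hA hB; have hM := blocks_adj hA hB.
have MK1 : blocks A B *m K1 = K1 *m A.
  by rewrite mulmxDl -!mulmxA K11 K21 !mulmx0 addr0 mulmx1.
have MK2 : blocks A B *m K2 = K2 *m B.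
  by rewrite mulmxDl -!mulmxA K12 K22 !mulmx0 add0r mulmx1.
rewrite -[LHS]mulmx1 -KK mulmxDr !mulmxA.
by rewrite (mxfun_intertwine phi hM hA MK1) (mxfun_intertwine phi hM hB MK2).
Qed.
End OrthogonalBlocks.

Section RotatedBlocks.
Variables (m : nat) (c s : R) (J1 J2 : 'M[C]_(m + m, m)).
Hypothesis cs : c ^+ 2 + s ^+ 2 = 1.
Hypotheses (J11 : J1^t* *m J1 = 1%:M) (J22 : J2^t* *m J2 = 1%:M).
Hypothesis J12 : J1^t* *m J2 = 0.

(** With [rot2], the pair [J1], [J2] turned by the angle of cosine [c] and sine [s]. *)
Definition rot1 := c%:C *: J1 - s%:C *: J2.
Definition rot2 := s%:C *: J1 + c%:C *: J2.

Lemma rot1_adj : rot1^t* = c%:C *: J1^t* - s%:C *: J2^t*.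
Proof. by rewrite conjtrD conjtrN !conjtrZ. Qed.

Lemma rot2_adj : rot2^t* = s%:C *: J1^t* + c%:C *: J2^t*.
Proof. by rewrite conjtrD !conjtrZ. Qed.

Let csC : c%:C * c%:C + s%:C * s%:C = 1 :> C.
Proof. by rewrite -!rmorphM -rmorphD -!expr2 cs. Qed.

Let J21 : J2^t* *m J1 = 0.
Proof.
by have := congr1 (fun X => X^t*) J12; rewrite conjtrM trmxCK trmx0 map_mx0.
Qed.

Lemma rot11 : rot1^t* *m rot1 = 1%:M.
Proof.
rewrite rot1_adj /rot1 !(mulmxDl, mulmxDr, mulNmx, mulmxN).
rewrite -!scalemxAl -!scalemxAr J11 J22 J12 J21 !scaler0 !(oppr0, addr0, add0r).
by rewrite opprK !scalerA -scalerDl csC scale1r.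
Qed.

Lemma rot22 : rot2^t* *m rot2 = 1%:M.
Proof.
rewrite rot2_adj /rot2 !(mulmxDl, mulmxDr).
rewrite -!scalemxAl -!scalemxAr J11 J22 J12 J21 !scaler0 !(addr0, add0r).
by rewrite !scalerA -scalerDl addrC csC scale1r.
Qed.

Lemma rot12 : rot1^t* *m rot2 = 0.
Proof.
rewrite rot1_adj /rot2 !(mulmxDl, mulmxDr, mulNmx, mulmxN).
rewrite -!scalemxAl -!scalemxAr J11 J22 J12 J21 !scaler0 !(oppr0, addr0, add0r).
by rewrite !scalerA [_ * c%:C]mulrC subrr.
Qed.

(* Young's inequality absorbs the off-diagonal block [E] of the rotated matrix
   into [e] on the first diagonal block and [e^-1 E^2] on the second one. *)
Lemma rotated_blocks_le (A B X Y E : 'M[C]_m) (e : R) : 0 < e ->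
  A^t* = A -> B^t* = B -> X^t* = X -> Y^t* = Y -> E^t* = E ->
  (forall x y, bform E x y = c * s * (bform B x y - bform A x y)) ->
  (forall x, qform X x =
    c ^+ 2 * qform A x + s ^+ 2 * qform B x + e * qform 1%:M x) ->
  (forall y, qform Y y =
    s ^+ 2 * qform A y + c ^+ 2 * qform B y + e^-1 * qform 1%:M (E *m y)) ->
  loewner_le (blocks rot1 rot2 A B) (blocks J1 J2 X Y).
Proof.
move=> e0 hA hB hX hY hE EE XE YE; apply/possemidefE; split.
  rewrite conjtrD conjtrN (blocks_adj rot1 rot2 hA hB).
  by rewrite (blocks_adj J1 J2 hX hY).
move=> v; rewrite qformB !qform_blocks rot1_adj rot2_adj.
rewrite !(mulmxDl, mulNmx) -!scalemxAl.
move: (J1^t* *m v) (J2^t* *m v) => x y.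
(* Once multiplied by [e], this square is exactly the difference of the two sides at [v]. *)
have q0 := posdef_ge0 (x + (- e^-1)%:C *: (E *m y)) (posdef1 m).
have {}q0 := mulr_ge0 (ltW e0) q0.
have {q0} : 0 <= e * qform 1%:M x - bform E x y - bform E y x
    + e^-1 * qform 1%:M (E *m y).
  move: q0; rewrite !qformE !(bformDl, bformDr) !(bformZl, bformZr).
  rewrite (bform_mulr _ E x) mul1mx (bform_mull _ E y x) hE mulmx1.
  move: (bform 1%:M x x) (bform E x y) (bform E y x) => t1 t2 t3.
  move: (bform _ _ _) => t4.
  congr (0 <= _); field.
  by rewrite gt_eqF.
rewrite XE YE !EE -[- (s%:C *: y)]scaleNr -rmorphN.
rewrite !qformE !(bformDl, bformDr) !(bformZl, bformZr).
move: (bform A x x) (bform A x y) (bform A y x) (bform A y y) => a1 a2 a3 a4.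
move: (bform B x x) (bform B x y) (bform B y x) (bform B y y) => b1 b2 b3 b4.
move: (bform 1%:M x x) (bform 1%:M _ _) => t1 t2 q0.
apply: le_trans q0 _; rewrite le_eqVlt; apply/orP; left; apply/eqP.
ring.
Qed.
End RotatedBlocks.

(** Applying [f] to the comparison of rotated and standard blocks reverses it. At [rot1 a + rot2 b]
    the rotated side is the right-hand side here, while the first standard component of that vector
    is [c a + s b]. The shift by [e] pays for the off-diagonal block. *)
Lemma operator_monotone_decreasing_shifted m (c s e : R) (A B : 'M[C]_m)
    (f : R -> R) : c ^+ 2 + s ^+ 2 = 1 -> 0 < e ->
  (forall x, 0 < x -> 0 < f x) -> operator_monotone_decreasing f ->
  posdef A -> posdef B ->
  forall a b, qform (mxfun f ((c ^+ 2)%:C *: A + (s ^+ 2)%:C *: B + e%:C *: 1%:M))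
      (c%:C *: a + s%:C *: b)
    <= qform (mxfun f A) a + qform (mxfun f B) b.
Proof.
move=> cs e0 f0 fmd pA pB a b.
have hA := posdef_adj pA; have hB := posdef_adj pB.
have weighted_gt0 (x y : R) : 0 < x -> 0 < y -> 0 < c ^+ 2 * x + s ^+ 2 * y.
  move=> x0 y0; have [c0|c0] := eqVneq (c ^+ 2) 0.
    by move: cs; rewrite c0 add0r => ->; rewrite mul0r add0r mul1r.
  apply: ltr_pwDl; last by rewrite mulr_ge0 ?sqr_ge0 ?ltW.
  by rewrite mulr_gt0 // lt_neqAle eq_sym c0 sqr_ge0.
have [J1 [J2 [J11 J22 J12]]] : exists J1 J2 : 'M[C]_(m + m, m),
    [/\ J1^t* *m J1 = 1%:M, J2^t* *m J2 = 1%:M & J1^t* *m J2 = 0].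
  exists (col_mx 1%:M 0), (col_mx 0 1%:M).
  rewrite !tr_col_mx !map_row_mx conjtr1 trmx0 map_mx0 !mul_row_col.
  by rewrite !(mulmx1, mulmx0, mul0mx) !(addr0, add0r).
(* [E] is the off-diagonal block of the rotated matrix in the basis [J1], [J2]. *)
have [E EE] : exists E, E = (c * s)%:C *: (B - A) by eexists.
have hE : E^t* = E by rewrite EE conjtrZ conjtrD conjtrN hA hB.
have bE x y : bform E x y = c * s * (bform B x y - bform A x y).
  rewrite EE bformZA bformDA; congr (_ * (_ + _)).
  by rewrite /bform mulmxN mulNmx mxE raddfN.
set X := _ + _ + _.
have qX x : qform X x
    = c ^+ 2 * qform A x + s ^+ 2 * qform B x + e * qform 1%:M x.
  by rewrite !qformD !qformZ.
have hX : X^t* = X.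
  by rewrite /X; do !apply: hermitianD; apply: hermitianZ => //; exact: conjtr1.
have [Y [hY qY]] : exists Y : 'M[C]_m, Y^t* = Y /\ forall y, qform Y y =
    s ^+ 2 * qform A y + c ^+ 2 * qform B y + e^-1 * qform 1%:M (E *m y).
  exists ((s ^+ 2)%:C *: A + (c ^+ 2)%:C *: B
    + e^-1%:C *: (E^t* *m 1%:M *m E)); split=> [|y]; last first.
    by rewrite !qformD !qformZ qform_conj.
  have hG : (E^t* *m 1%:M *m E)^t* = E^t* *m 1%:M *m E.
    by rewrite !conjtrM trmxCK conjtr1 mulmxA.
  by do !apply: hermitianD; apply: hermitianZ.
have [_ A0] := (posdefP A).1 pA; have [_ B0] := (posdefP B).1 pB.
have pX : posdef X.
  apply/posdefP; split; first exact: hX.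
  move=> x x0; rewrite qX ltr_pwDl ?weighted_gt0 ?A0 ?B0 //.
  by apply: mulr_ge0; [exact: ltW | apply: posdef_ge0; exact: posdef1].
have pY : posdef Y.
  apply/posdefP; split; first exact: hY.
  move=> x x0; rewrite qY ltr_pwDl 1?addrC ?weighted_gt0 ?A0 ?B0 //.
  apply: mulr_ge0; first by rewrite invr_ge0 ltW.
  by apply: posdef_ge0; exact: posdef1.
have r11 := rot11 cs J11 J22 J12; have r22 := rot22 cs J11 J22 J12.
have r12 := rot12 c s J11 J22 J12.
have pM := posdef_blocks r11 r22 r12 pA pB.
have pN := posdef_blocks J11 J22 J12 pX pY.
have := fmd _ _ _ pM pN (rotated_blocks_le J1 J2 e0 hA hB hX hY hE bE qX qY).
move=> /loewner_leP /(_ (rot1 c s J1 J2 *m a + rot2 c s J1 J2 *m b)).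
rewrite (mxfun_blocks r11 r22 r12 f hA hB) (mxfun_blocks J11 J22 J12 f hX hY).
have r21 : (rot2 c s J1 J2)^t* *m rot1 c s J1 J2 = 0.
  by have := congr1 (fun X => X^t*) r12; rewrite conjtrM trmxCK trmx0 map_mx0.
rewrite !qform_blocks !mulmxDr !(mulmxA _ (rot1 _ _ _ _) a).
rewrite !(mulmxA _ (rot2 _ _ _ _) b) r11 r12 r21 r22.
rewrite !mul1mx !mul0mx addr0 add0r.
have -> : J1^t* *m rot1 c s J1 J2 = c%:C *: 1%:M.
  by rewrite mulmxDr mulmxN -!scalemxAr J11 J12 scaler0 subr0.
have -> : J1^t* *m rot2 c s J1 J2 = s%:C *: 1%:M.
  by rewrite mulmxDr -!scalemxAr J11 J12 scaler0 addr0.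
(* The contribution of [mxfun f Y] is nonnegative and is dropped. *)
rewrite -!scalemxAl !mul1mx; apply: le_trans.
by rewrite lerDl; apply: posdef_ge0; exact: posdef_mxfun.
Qed.

Lemma mxfun_real_diag n (d : 'I_n -> R) (phi : R -> R) :
  mxfun phi (rdiag d) = rdiag (phi \o d).
Proof.
by rewrite (@mxfun_rdiag _ _ _ 1%:M d) ?conjtr1 ?mul1mx ?mulmx1.
Qed.

Lemma rdiag_comb n (s r : R) (d e : 'I_n -> R) :
  s%:C *: rdiag d + r%:C *: rdiag e = rdiag (fun i => s * d i + r * e i).
Proof.
apply/matrixP => i j; rewrite !mxE; case: (i == j); last by rewrite !mulr0 addr0.
by rewrite !mulr1n rmorphD !rmorphM.
Qed.

Lemma posdef_rdiag n (d : 'I_n -> R) : (forall i, 0 < d i) -> posdef (rdiag d).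
Proof.
move=> d0; split; last by apply/unitmx_rdiag => i; rewrite gt_eqF.
apply/possemidefE; split; first exact: rdiag_adj.
move=> v; rewrite qform_rdiag sumr_ge0 // => i _.
by rewrite mulr_ge0 ?normsq_ge0 // ltW.
Qed.

(* A quantitative right-continuity: operator monotonicity already forces it on
   [1 x 1] matrices. *)
Lemma operator_monotone_decreasing_right_lip (f : R -> R) :
  (forall x, 0 < x -> 0 < f x) -> operator_monotone_decreasing f ->
  forall x e, 0 < x -> 0 < e -> f x - 4 * e / x * f x <= f (x + e).
Proof.
move=> f0 fmd x e x0 e0.
have fx := f0 _ x0; have fxe := f0 _ (addr_gt0 x0 e0).
(* Here the left-hand side is at most zero. *)
have [xe|ex] := leP x (4 * e).
  apply: le_trans (ltW fxe); rewrite -[X in X - _]mul1r -mulrBl.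
  by rewrite mulr_le0_ge0 ?(ltW fx) // subr_le0 ler_pdivlMr // mul1r.
(* Solution of [t (x / 2) + (1 - t) (x + e) + e = x]. Testing at [a = 0] then leaves
   [(1 - t) f x <= f (x + e)]. *)
set t := 4 * e / (x + 2 * e).
have x2e : 0 < x + 2 * e by lra.
have t0 : 0 < t by rewrite divr_gt0 //; lra.
have t1 : t < 1 by rewrite ltr_pdivrMr //; lra.
have tx : t <= 4 * e / x by rewrite ler_pM2l ?lef_pV2 ?posrE //; lra.
have st : Num.sqrt t ^+ 2 = t by rewrite sqr_sqrtr // ltW.
have s1t : Num.sqrt (1 - t) ^+ 2 = 1 - t by rewrite sqr_sqrtr // subr_ge0 ltW.
have pA : posdef (rdiag (fun=> x / 2) : 'M[C]_1) by apply: posdef_rdiag => _; lra.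
have pB : posdef (rdiag (fun=> x + e) : 'M[C]_1) by apply: posdef_rdiag => _; lra.
have cs : Num.sqrt t ^+ 2 + Num.sqrt (1 - t) ^+ 2 = 1 by rewrite st s1t; lra.
have := operator_monotone_decreasing_shifted cs e0 f0 fmd pA pB 0 (const_mx 1).
rewrite st s1t rdiag_comb -rdiag1 -[rdiag (fun=> _ + _)]scale1r.
rewrite -[1]/(1%:C) rdiag_comb !mxfun_real_diag scaler0 add0r qform_scalev s1t.
rewrite !qform_rdiag !big_ord1 !mxE /= !normsq0 normsq1 !mulr1 mulr0 add0r.
have -> : 1 * (t * (x / 2) + (1 - t) * (x + e)) + e = x.
  have tE : t * (x + 2 * e) = 4 * e by rewrite /t mulfVK // gt_eqF.
  by move: tE; lra.
apply: le_trans; rewrite [leRHS]mulrBl mul1r lerD2l lerN2.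
by rewrite ler_pM2r.
Qed.

Lemma mxfun_shift n (A : 'M[C]_n) (e : R) (phi : R -> R) : A^t* = A ->
  mxfun phi (A + e%:C *: 1%:M) = mxfun (fun x => phi (x + e)) A.
Proof.
move=> /spectral_decomposition[P [d [P1 P2 AE ->]]].
apply: (@mxfun_rdiag _ _ _ P (fun i => d i + e)); first exact: P1.
have PE : P^t* *m P = P^t* *m rdiag (fun=> 1) *m P by rewrite rdiag1 mulmx1.
have dE : rdiag d + e%:C *: rdiag (fun=> 1) = rdiag (fun i => d i + e).
  apply/matrixP => i j; rewrite !mxE; case: (i == j).
    by rewrite !mulr1n rmorphD mulr1.
  by rewrite !mulr0n mulr0 addr0.
by rewrite AE -P1 PE scalemxAl scalemxAr -mulmxDl -mulmxDr dE.
Qed.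

(** The scalar estimate summed over an eigenbasis; [K] is independent of [e], so the shift can be
    sent to zero. *)
Lemma qform_mxfun_shift n (A : 'M[C]_n) (f : R -> R) u :
  (forall x, 0 < x -> 0 < f x) -> operator_monotone_decreasing f -> posdef A ->
  exists2 K, 0 <= K & forall e, 0 < e ->
    qform (mxfun f A) u - e * K <= qform (mxfun (fun x => f (x + e)) A) u.
Proof.
move=> f0 fmd /posdef_spectral[P [d [P1 P2 AE fA d0]]].
exists (\sum_i 4 / d i * f (d i) * normsq ((P *m u) i 0)).
  apply: sumr_ge0 => i _; rewrite mulr_ge0 ?normsq_ge0 // ltW //.
  by rewrite mulr_gt0 ?divr_gt0 ?f0.
move=> e e0; rewrite !fA !qform_conj !qform_rdiag mulr_sumr -sumrB.
apply: ler_sum => i _; rewrite !mulrA -mulrBl ler_wpM2r ?normsq_ge0 //=.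
rewrite [e * 4]mulrC; exact: operator_monotone_decreasing_right_lip.
Qed.

(* Minimised over [a + b = u], the right-hand side is the parallel sum of
   [f A / t] and [f B / (1 - t)] at [u]; in this form no inverse appears. *)
Lemma operator_monotone_decreasing_parallel m (t : R) (A B : 'M[C]_m)
    (f : R -> R) : 0 < t < 1 ->
  (forall x, 0 < x -> 0 < f x) -> operator_monotone_decreasing f ->
  posdef A -> posdef B ->
  forall a b, qform (mxfun f (t%:C *: A + (1 - t)%:C *: B)) (a + b)
    <= t^-1 * qform (mxfun f A) a + (1 - t)^-1 * qform (mxfun f B) b.
Proof.
move=> /andP[t0 t1] f0 fmd pA pB a b.
have t1' : 0 < 1 - t by rewrite subr_gt0.
have pX : posdef (t%:C *: A + (1 - t)%:C *: B).
  by apply: posdefD (posdefZ t0 pA) _; exact: (posdefZ t1' pB).1.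
have [K K0 XK] := qform_mxfun_shift (a + b) f0 fmd pX.
apply/ler_addgt0Pr => e e0.
have eK0 : 0 < e / (K + 1) by rewrite divr_gt0 // ltr_wpDl.
have eK : e / (K + 1) * K <= e.
  rewrite mulrAC ler_pdivrMr ?ltr_wpDl // mulrDr mulr1 lerDl; exact: ltW.
have st : Num.sqrt t ^+ 2 = t by rewrite sqr_sqrtr // ltW.
have s1t : Num.sqrt (1 - t) ^+ 2 = 1 - t by rewrite sqr_sqrtr // ltW.
have cs : Num.sqrt t ^+ 2 + Num.sqrt (1 - t) ^+ 2 = 1 by rewrite st s1t; lra.
(* With [c] and [s] the square roots of [t] and [1 - t], this rescaling turns [c a + s b] into
   [a + b] and produces the weights [t^-1] and [(1 - t)^-1]. *)
have := operator_monotone_decreasing_shifted cs eK0 f0 fmd pA pB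
  ((Num.sqrt t)^-1%:C *: a) ((Num.sqrt (1 - t))^-1%:C *: b).
rewrite st s1t (mxfun_shift (e / (K + 1)) f (posdef_adj pX)) !qform_scalev !scalerA.
rewrite -!rmorphM !divff ?gt_eqF ?sqrtr_gt0 // !scale1r !exprVn st s1t.
move=> fab; have := le_trans (XK _ eK0) fab.
by rewrite lerBlDr => /le_trans; apply; rewrite lerD2l.
Qed.

End OperatorMonotone.

(** * Positive linear maps, parallel sums and operator concavity of inverses *)

Section PositiveMaps.
Local Open Scope sesquilinear_scope.
Context {R : realType}.
Local Notation C := R[i].

Lemma normsqZ (s : R) (z : C) : normsq (s%:C * z) = s ^+ 2 * normsq z.
Proof. by case: z => a b; rewrite /normsq /= !mul0r subr0 addr0; ring. Qed.

(** Congruence by the inverse square root of [P + Q] sends the sum to the identity, so a unitary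
    diagonalising the image of [P] also diagonalises that of [Q]. *)
Lemma simultaneous_diagonalization n (P Q : 'M[C]_n) :
  P^t* = P -> posdef (P + Q) ->
  exists2 c : 'M[C]_n, c \in unitmx & exists d : 'I_n -> R,
    P = c *m rdiag d *m c^t* /\ Q = c *m rdiag (fun i => 1 - d i) *m c^t*.
Proof.
move=> hP pPQ; have pS := posdef_sqrt pPQ; have SS := mxfun_sqrtK pPQ.
move: (mxfun Num.sqrt _) pS SS => S pS SS.
have hS := posdef_adj pS; have uS := pS.2; have hSi := posdef_adj (posdef_inv pS).
have hM : (invmx S *m P *m invmx S)^t* = invmx S *m P *m invmx S.
  by rewrite !conjtrM hP hSi mulmxA.
have [V [d [V1 V2 ME _]]] := spectral_decomposition hM.
have PE : P = S *m V^t* *m rdiag d *m (S *m V^t*)^t*.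
  have -> : P = S *m (invmx S *m P *m invmx S) *m S.
    by rewrite -!mulmxA (mulVmx uS) mulmx1 (mulKVmx uS).
  by rewrite ME conjtrM trmxCK hS !mulmxA.
exists (S *m V^t*); first by rewrite unitmx_mul uS; case: (mulmx1_unit V2).
exists d; split; first exact: PE.
have -> : rdiag (fun i => 1 - d i) = 1%:M - rdiag d.
  rewrite -rdiag1; apply/matrixP => i j; rewrite !mxE.
  by case: (i == j); rewrite ?mulr1n ?mulr0n ?subr0 // rmorphB.
rewrite mulmxBr mulmxBl -PE mulmx1 conjtrM trmxCK hS.
by rewrite -!mulmxA (mulmxA (V^t*)) V1 mul1mx SS [P + Q]addrC addrK.
Qed.

Lemma qform_congr n (c : 'M[C]_n) (d : 'I_n -> R) v :
  qform (c *m rdiag d *m c^t*) v = \sum_i d i * normsq ((c^t* *m v) i 0).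
Proof. by rewrite -{1}(trmxCK c) qform_conj qform_rdiag. Qed.

(* The right-hand side is the parallel sum of [c d c*] and [c (1 - d) c*]; the
   two vectors below realise the infimum defining it. *)
Lemma le_parallel_sum n (G c : 'M[C]_n) (d : 'I_n -> R) : c \in unitmx ->
  (forall a b, qform G (a + b) <= qform (c *m rdiag d *m c^t*) a
    + qform (c *m rdiag (fun i => 1 - d i) *m c^t*) b) ->
  forall u, qform G u <= qform (c *m rdiag (fun i => d i * (1 - d i)) *m c^t*) u.
Proof.
move=> uc Gab u.
have uc' : c^t* \in unitmx by rewrite map_unitmx unitmx_tr.
pose ci := invmx (c^t*).
have cK w : c^t* *m (ci *m w) = w :> 'cV_n := mulKVmx uc' w.
have := Gab (ci *m (rdiag (fun i => 1 - d i) *m (c^t* *m u)))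
            (ci *m (rdiag d *m (c^t* *m u))).
rewrite -mulmxDr -mulmxDl.
have -> : rdiag (fun i => 1 - d i) + rdiag d = 1%:M.
  rewrite -rdiag1; apply/matrixP => i j; rewrite !mxE.
  by case: (i == j); rewrite ?mulr1n ?mulr0n ?addr0 // -rmorphD subrK.
rewrite mul1mx (mulKmx uc') => /le_trans; apply.
rewrite 3!qform_congr 2!cK -big_split /=.
(* Termwise equality: [d (1 - d)^2 + (1 - d) d^2 = d (1 - d)]. *)
apply: ler_sum => i _; rewrite !mul_diag_mx !mxE !normsqZ.
by rewrite le_eqVlt; apply/orP; left; apply/eqP; ring.
Qed.

(** Splitting into rank-one semidefinite terms lets a positive linear map act on each term while
    keeping the coefficients [d i]. *)
Lemma congr_rdiag_sum n (c : 'M[C]_n) (d : 'I_n -> R) :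
  c *m rdiag d *m c^t* = \sum_i (d i)%:C *: (col i c *m (col i c)^t*).
Proof.
apply/matrixP => j k; rewrite mxE summxE; apply: eq_bigr => i _.
rewrite mul_mx_diag !mxE big_ord1 !mxE; ring.
Qed.

Section StrictlyPositive.
Variables (n k : nat) (Phi : {linear 'M[C]_n -> 'M[C]_k}).
Hypothesis Phi_pos : strictly_positive Phi.

(** Perturb [A] to the positive definite [e 1 + A] and let [e] tend to zero. *)
Lemma positive_map A : possemidef A -> possemidef (Phi A).
Proof.
move=> pA.
have pe e : 0 < e -> posdef (Phi (e%:C *: 1%:M + A)).
  by move=> e0; apply: Phi_pos; apply: posdefD (posdefZ e0 (posdef1 _)) pA.
have p1 := Phi_pos (posdef1 n).
apply/possemidefE; split.
  have -> : Phi A = Phi (1%:C *: 1%:M + A) - Phi 1%:M.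
    by rewrite scale1r raddfD /= addrC addKr.
  by rewrite conjtrD conjtrN (posdef_adj p1) (posdef_adj (pe _ ltr01)).
move=> v; apply/ler_addgt0Pr => e e0.
have K0 := posdef_ge0 v p1; set K := qform _ v in K0.
have eK0 : 0 < e / (K + 1) by rewrite divr_gt0 // ltr_wpDl.
have eK : e / (K + 1) * K <= e.
  rewrite mulrAC ler_pdivrMr ?ltr_wpDl // mulrDr mulr1 lerDl; exact: ltW.
have := posdef_ge0 v (pe _ eK0); rewrite raddfD /= linearZ /= qformD qformZ -/K.
by move=> /le_trans; apply; rewrite addrC lerD2l.
Qed.

Lemma positive_map_le A B v : A^t* = A -> B^t* = B ->
  (forall u, qform A u <= qform B u) -> qform (Phi A) v <= qform (Phi B) v.
Proof.
move=> hA hB AB; rewrite -subr_ge0 -qformB -raddfB.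
have /positive_map/possemidefE[_] : possemidef (B - A); last exact.
apply/possemidefE; split; first by rewrite conjtrD conjtrN hA hB.
by move=> u; rewrite qformB subr_ge0.
Qed.

(** After simultaneous diagonalisation [G] lies below the explicit parallel sum, which [Phi] maps to
    a combination of semidefinite matrices with coefficients [d i (1 - d i)]; each term is bounded
    by the weighted identity for a single form. *)
Lemma positive_map_parallel (G P Q : 'M[C]_n) :
  G^t* = G -> P^t* = P -> posdef (P + Q) ->
  (forall a b, qform G (a + b) <= qform P a + qform Q b) ->
  forall a b, qform (Phi G) (a + b) <= qform (Phi P) a + qform (Phi Q) b.
Proof.
move=> hG hP pPQ GPQ a b.
have [c uc [d [PE QE]]] := simultaneous_diagonalization hP pPQ.
rewrite {}PE {}QE {P Q hP pPQ} in GPQ *.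
have hd e : (c *m rdiag e *m c^t*)^t* = c *m rdiag e *m c^t*.
  by rewrite !conjtrM rdiag_adj trmxCK mulmxA.
apply: le_trans (positive_map_le _ hG (hd _) (le_parallel_sum uc GPQ)) _.
rewrite !congr_rdiag_sum !raddf_sum !qform_sum -big_split /=.
apply: ler_sum => i _; rewrite !linearZ /= !qformZ.
have /positive_map/possemidefE[_ E0] : possemidef (col i c *m (col i c)^t*).
  apply/possemidefE; split; first by rewrite conjtrM trmxCK.
  have -> : col i c *m (col i c)^t*
      = ((col i c)^t*)^t* *m 1%:M *m (col i c)^t* by rewrite trmxCK mulmx1.
  move=> v; rewrite qform_conj.
  by apply: posdef_ge0; exact: posdef1.
have := E0 ((d i)%:C *: a + (- (1 - d i))%:C *: b).
by rewrite -qform_weighted ?subr_ge0 // addrC subrK.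
Qed.
End StrictlyPositive.

Lemma qformD_cross n (A : 'M[C]_n) u v :
  qform A (u + v) = qform A u + (bform A u v + bform A v u) + qform A v.
Proof. by rewrite /qform -!/(bform _ _ _) bformDl !bformDr !addrA. Qed.

(* Testing at [a = t X1^-1 v], [b = (1 - t) X2^-1 v] realises the infimum that
   defines the parallel sum of [X1 / t] and [X2 / (1 - t)]. *)
Lemma inverse_of_parallel k (t : R) (X0 X1 X2 : 'M[C]_k) : 0 < t < 1 ->
  posdef X0 -> posdef X1 -> posdef X2 ->
  (forall a b, qform X0 (a + b)
    <= t^-1 * qform X1 a + (1 - t)^-1 * qform X2 b) ->
  forall v, t * qform (invmx X1) v + (1 - t) * qform (invmx X2) v
    <= qform (invmx X0) v.
Proof.
move=> /andP[t0 t1] p0 p1 p2 X012 v.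
have inv_qform (X : 'M[C]_k) w : posdef X ->
    qform X (invmx X *m w) = qform (invmx X) w.
  move=> pX; have hXi := posdef_adj (posdef_inv pX).
  by rewrite -qform_conj hXi (mulVmx pX.2) mul1mx.
have [w1 w1E] : exists w, w = invmx X1 *m v by eexists.
have [w2 w2E] : exists w, w = invmx X2 *m v by eexists.
have [w0 w0E] : exists w, w = invmx X0 *m v by eexists.
have bl Y : posdef Y -> bform X0 (invmx Y *m v) w0 = qform (invmx Y) v.
  move=> pY; rewrite w0E bform_mulr (mulmxV p0.2) bform_mull mulmx1.
  by rewrite (posdef_adj (posdef_inv pY)).
have br Y : posdef Y -> bform X0 w0 (invmx Y *m v) = qform (invmx Y) v.
  move=> pY; rewrite w0E bform_mulr bform_mull mulmxA.
  by rewrite (posdef_adj (posdef_inv p0)) (mulVmx p0.2) mul1mx.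
move: (inv_qform X1 v p1) (inv_qform X2 v p2) (inv_qform X0 v p0).
move: (bl X1 p1) (bl X2 p2) (br X1 p1) (br X2 p2).
rewrite -w0E -w1E -w2E.
move: (qform (invmx X1) v) (qform (invmx X2) v) (qform (invmx X0) v) => a b c.
move=> l1 l2 r1 r2 i1 i2 i0.
have := X012 (t%:C *: w1) ((1 - t)%:C *: w2).
rewrite 2!qform_scalev i1 i2.
(* Put [l = t a + (1 - t) b]. This square gives [2 l - c <= X0(t w1 + (1 - t) w2)], and the
   hypothesis bounds the right-hand side by [l]; hence [l <= c]. *)
have := posdef_ge0 (t%:C *: w1 + (1 - t)%:C *: w2 + (-1)%:C *: w0) p0.
rewrite (qformD_cross _ (_ + _)) qform_scalev i0 bformDl !bformDr.
rewrite !bformZl !bformZr l1 l2 r1 r2.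
move: (qform X0 _) => q0.
have -> : t^-1 * (t ^+ 2 * a) = t * a by field; rewrite gt_eqF.
have -> : (1 - t)^-1 * ((1 - t) ^+ 2 * b) = (1 - t) * b.
  by field; rewrite gt_eqF // subr_gt0.
rewrite sqrrN expr1n mul1r !mulN1r !mulrN.
by move: (t * a) ((1 - t) * b) => x y; clear; lra.
Qed.

(** Operator concavity of the inverse of [Phi (f A)], which is stronger than operator convexity of
    [Phi (f A)]: the parallel-sum bound is carried through [Phi] and then inverted. *)
Lemma strengthened_convexity n k (t : R) (A B : 'M[C]_n) (f : R -> R)
    (Phi : {linear 'M[C]_n -> 'M[C]_k}) : 0 < t < 1 ->
  (forall x, 0 < x -> 0 < f x) -> operator_monotone_decreasing f ->
  strictly_positive Phi -> posdef A -> posdef B ->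
  forall v, t * qform (invmx (Phi (mxfun f A))) v
    + (1 - t) * qform (invmx (Phi (mxfun f B))) v
    <= qform (invmx (Phi (mxfun f (t%:C *: A + (1 - t)%:C *: B)))) v.
Proof.
move=> t01 f0 fmd Phi_pos pA pB.
have /andP[t0 t1] := t01; have t1' : 0 < 1 - t by rewrite subr_gt0.
have pX : posdef (t%:C *: A + (1 - t)%:C *: B).
  by apply: posdefD (posdefZ t0 pA) _; exact: (posdefZ t1' pB).1.
have pfA := posdef_mxfun f0 pA; have pfB := posdef_mxfun f0 pB.
have pfX := posdef_mxfun f0 pX.
have := operator_monotone_decreasing_parallel t01 f0 fmd pA pB.
move: (mxfun f A) (mxfun f B) (mxfun f (_ *: A + _ *: B)) pfA pfB pfX.
move=> P Q G pP pQ pG GPQ.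
apply: (inverse_of_parallel t01 (Phi_pos _ pG) (Phi_pos _ pP) (Phi_pos _ pQ)).
have pP' : posdef (t^-1%:C *: P) by apply: posdefZ pP; rewrite invr_gt0.
have pQ' : posdef ((1 - t)^-1%:C *: Q) by apply: posdefZ pQ; rewrite invr_gt0.
have GPQ' a b : qform G (a + b)
    <= qform (t^-1%:C *: P) a + qform ((1 - t)^-1%:C *: Q) b.
  by rewrite 2!qformZ; exact: GPQ.
have := positive_map_parallel Phi_pos (posdef_adj pG) (posdef_adj pP')
  (posdefD pP' pQ'.1) GPQ'.
by rewrite 2!linearZ => PAB a b; have := PAB a b; rewrite 2!qformZ.
Qed.
End PositiveMaps.

(** * Convexity on the half-line and the Legendre transform [breve] *)

Section ScalarFunctions.
Context {R : realType}.
Implicit Types phi k : R -> R.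

Definition convex_pos phi := forall x y t : R, 0 < x -> 0 < y -> 0 <= t <= 1 ->
  phi (t * x + (1 - t) * y) <= t * phi x + (1 - t) * phi y.

(** The slope is the supremum of the difference quotients to the left of [x0], each of which lies
    below every quotient to the right. *)
Lemma convex_supporting_line phi : convex_pos phi ->
  forall x0, 0 < x0 ->
  exists p, forall x, 0 < x -> phi x0 + p * (x - x0) <= phi x.
Proof.
move=> cphi x0 x00.
pose slopes := [set (phi x0 - phi x) / (x0 - x) | x in [set x | 0 < x < x0]].
have slope_le x y : 0 < x -> x < x0 -> x0 < y ->
    (phi x0 - phi x) / (x0 - x) <= (phi y - phi x0) / (y - x0).
  move=> xp xx0 x0y.
  have yx : 0 < y - x by rewrite subr_gt0 (lt_trans xx0).
  have t01 : 0 <= (y - x0) / (y - x) <= 1.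
    apply/andP; split; first by rewrite divr_ge0 ?(ltW yx) // subr_ge0 ltW.
    by rewrite ler_pdivrMr // mul1r; lra.
  have := cphi x y _ xp (lt_trans x00 x0y) t01.
  have -> : (y - x0) / (y - x) * x + (1 - (y - x0) / (y - x)) * y = x0.
    by field; rewrite gt_eqF.
  have -> : (y - x0) / (y - x) * phi x + (1 - (y - x0) / (y - x)) * phi y
      = ((y - x0) * phi x + (x0 - x) * phi y) / (y - x).
    by field; rewrite gt_eqF.
  move=> cx; rewrite ler_pdivlMr // in cx.
  rewrite ler_pdivrMr ?subr_gt0 // mulrAC ler_pdivlMr ?subr_gt0 //.
  by move: cx; lra.
have slopes0 : slopes !=set0.
  by exists ((phi x0 - phi (x0 / 2)) / (x0 - x0 / 2)), (x0 / 2) => //=; lra.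
have slopes_ub : has_ubound slopes.
  exists ((phi (x0 + 1) - phi x0) / (x0 + 1 - x0)) => _ [x /andP[xp xx0] <-].
  by apply: slope_le => //; rewrite ltrDl.
exists (sup slopes) => x xp.
have [xx0|x0x|->] := ltgtP x x0; last by rewrite subrr mulr0 addr0.
  have : (phi x0 - phi x) / (x0 - x) <= sup slopes.
    by apply: ub_le_sup => //; exists x => //=; rewrite xp.
  by rewrite ler_pdivrMr ?subr_gt0 //; lra.
have : sup slopes <= (phi x - phi x0) / (x - x0).
  by apply: ge_sup => // _ [z /andP[zp zx0] <-]; exact: slope_le.
by rewrite ler_pdivlMr ?subr_gt0 //; lra.
Qed.

(* The gap between [k] and its chord is bounded above, and halving the parameter
   shows that its supremum is at most half of itself. *)
Lemma midpoint_convex_nonincreasing k :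
  (forall x y, 0 < x -> x <= y -> k y <= k x) ->
  (forall x y, 0 < x -> 0 < y -> k ((x + y) / 2) <= (k x + k y) / 2) ->
  convex_pos k.
Proof.
move=> kdec kmid x y t xp yp t01.
pose g s := k (s * x + (1 - s) * y) - (s * k x + (1 - s) * k y).
have pt s : 0 <= s <= 1 -> 0 < s * x + (1 - s) * y.
  move=> /andP[s0 s1]; have [->|s0'] := eqVneq s 0; first by lra.
  rewrite ltr_pwDl ?mulr_ge0 ?subr_ge0 ?(ltW yp) //.
  by rewrite mulr_gt0 // lt_neqAle eq_sym s0'.
have gmid s r : 0 <= s <= 1 -> 0 <= r <= 1 -> g ((s + r) / 2) <= (g s + g r) / 2.
  move=> s01 r01; have := kmid _ _ (pt _ s01) (pt _ r01); rewrite /g.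
  have -> : (s * x + (1 - s) * y + (r * x + (1 - r) * y)) / 2
      = (s + r) / 2 * x + (1 - (s + r) / 2) * y by field.
  by lra.
have g0 : g 0 = 0 by rewrite /g !mul0r !subr0 !mul1r !add0r subrr.
have g1 : g 1 = 0 by rewrite /g !subrr !mul1r !mul0r !addr0 subrr.
pose G := [set g s | s in [set s : R | 0 <= s <= 1]].
have G0 : G !=set0 by exists (g 0), 0 => //=; lra.
have Gub : has_ubound G.
  (* Monotonicity bounds [k] on the segment by its value at [Num.min x y]; the chord is bounded by
     the values at its ends. *)
  exists (2 * `|k x| + 2 * `|k y|) => _ [s /= s01 <-].
  have m0 : 0 < Num.min x y by rewrite lt_min xp yp.
  have kle : k (s * x + (1 - s) * y) <= k (Num.min x y).
    apply: kdec => //.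
    have mx : Num.min x y <= x by rewrite ge_min lexx.
    have my : Num.min x y <= y by rewrite ge_min lexx orbT.
    have /andP[s0 s1] := s01.
    have -> : Num.min x y = s * Num.min x y + (1 - s) * Num.min x y by ring.
    by rewrite lerD // ler_wpM2l // subr_ge0.
  have km : k (Num.min x y) <= `|k x| + `|k y|.
    rewrite /Num.min; case: ifP => _.
      by rewrite -[leLHS]addr0 lerD ?ler_norm.
    by rewrite -[leLHS]add0r lerD ?ler_norm.
  have /andP[s0 s1] := s01.
  have a1 : - (s * k x) <= `|k x|.
    rewrite -mulrN; apply: le_trans (ler_norm _) _; rewrite normrM normrN.
    by rewrite ger0_norm // ler_piMl.
  have a2 : - ((1 - s) * k y) <= `|k y|.
    rewrite -mulrN; apply: le_trans (ler_norm _) _; rewrite normrM normrN.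
    by rewrite ger0_norm ?subr_ge0 // ler_piMl // gerBl.
  by rewrite /g; lra.
have gS s : 0 <= s <= 1 -> g s <= sup G.
  by move=> s01; apply: ub_le_sup => //; exists s.
have S0 : sup G <= sup G / 2.
  apply: ge_sup => // _ [s /= /andP[s0 s1] <-].
  (* [s] is the midpoint of [0] and [2 s], or of [1] and [2 s - 1]; since [g] vanishes at [0] and
     [1], [g s] is at most half the supremum. *)
  have [s2|s2] := leP s (1 / 2).
    have s01 : 0 <= 2 * s <= 1 by lra.
    have := gmid 0 (2 * s); have := gS _ s01; rewrite g0 s01 lexx ler01 !add0r.
    by rewrite mulrAC divff // mul1r => a /(_ isT isT); lra.
  have s01 : 0 <= 2 * s - 1 <= 1 by lra.
  have := gmid 1 (2 * s - 1); have := gS _ s01; rewrite g1 s01 lexx ler01.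
  have -> : (1 + (2 * s - 1)) / 2 = s by field.
  by move=> a /(_ isT isT); lra.
by have := gS _ t01; rewrite /g; lra.
Qed.

Section Breve.
Variable h : R -> R.
Hypothesis h_mono : forall x y : R, 0 < x -> x <= y -> h x <= h y.
Hypothesis h_lim : h x * x @[x --> 0^'+] --> (0 : R).

Let dual t := [set t * x - tilde h x | x in [set x : R | 0 < x]].

(** For [x^-1] close to [0] the limit hypothesis gives [h x^-1 > - t x], so the value is positive;
    for [x^-1 >= d] monotonicity gives the bound [h d]. *)
Lemma breve_lbound t : 0 < t -> has_lbound (dual t).
Proof.
move=> t0; have : \forall x \near 0^'+, `|h x * x| < t.
  move/cvgr0_norm_lt : h_lim; exact.
move=> [d /= d0 dh]; exists (Num.min 0 (h d)) => _ [x /= x0 <-].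
rewrite /tilde opprK ge_min.
have xi0 : 0 < x^-1 by rewrite invr_gt0.
have [dx|xd] := leP d x^-1.
  by apply/orP; right; have := h_mono d0 dx; have := mulr_gt0 t0 x0; lra.
apply/orP; left; have := dh x^-1; rewrite /= sub0r normrN gtr0_norm //.
move=> /(_ xd xi0); rewrite ltr_norml => /andP[+ _].
rewrite ltr_pdivlMr // => /ltW; lra.
Qed.

Lemma breve_le t x : 0 < t -> 0 < x -> breve h t <= t * x + h x^-1.
Proof.
move=> t0 x0; rewrite -[h _]opprK; apply: ge_inf; first exact: breve_lbound.
by exists x.
Qed.

Lemma breve_ge t c : (forall x, 0 < x -> c <= t * x + h x^-1) -> c <= breve h t.
Proof.
move=> ct; apply: lb_le_inf.
  by exists (t * 1 - tilde h 1), 1 => //=.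
by move=> _ [x /= x0 <-]; rewrite /tilde opprK ct.
Qed.

Lemma breve_mono s t : 0 < s -> s <= t -> breve h s <= breve h t.
Proof.
move=> s0 st; apply: breve_ge => x x0; apply: le_trans (breve_le s0 x0) _.
by rewrite lerD2r ler_wpM2r // ltW.
Qed.

Hypothesis h_convex : convex_pos (fun x => h x^-1).

(* Legendre duality; the supremum is only approached, not attained, where the
   supporting slope vanishes. *)
Lemma breve_duality x e : 0 < x -> 0 < e ->
  exists2 t, 0 < t & h x^-1 <= breve h t - t * x + e.
Proof.
move=> x0 e0; have [p hp] := convex_supporting_line h_convex x0.
have p0 : p <= 0.
  have x1 : 0 < x + 1 by rewrite addr_gt0.
  have := hp _ x1; have : h (x + 1)^-1 <= h x^-1.
    by apply: h_mono; rewrite ?invr_gt0 // lef_pV2 ?posrE // lerDl.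
  by lra.
have [pE|pN] := eqVneq p 0.
  (* A zero slope means that [h x^-1] is a global minimum, so [breve h t >= h x^-1] for any [t > 0];
     this [t] makes [t x] equal to [e]. *)
  exists (e / x); first exact: divr_gt0.
  rewrite mulfVK ?gt_eqF // subrK; apply: breve_ge => y y0.
  have := hp y y0; rewrite pE mul0r addr0 => /le_trans; apply.
  by rewrite lerDr mulr_ge0 ?ltW // divr_gt0.
exists (- p); first by rewrite oppr_gt0 lt_neqAle pN.
suff : h x^-1 - p * x <= breve h (- p) by move: e0; lra.
by apply: breve_ge => y y0; have := hp y y0; lra.
Qed.
End Breve.
End ScalarFunctions.

(** * Trace inequalities of Peierls and Klein type *)

Section TraceFunctionals.
Local Open Scope sesquilinear_scope.
Context {R : realType}.
Local Notation C := R[i].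

Definition retr n (A : 'M[C]_n) : R := complex.Re (\tr A).

Lemma qform_delta n (A : 'M[C]_n) i :
  qform A (delta_mx i 0) = complex.Re (A i i).
Proof. by rewrite /qform trmx_delta map_delta_mx -rowE -colE !mxE. Qed.

Lemma retrE n (A : 'M[C]_n) : retr A = \sum_i qform A (delta_mx i 0).
Proof.
rewrite /retr raddf_sum; apply: eq_bigr => i _.
by rewrite qform_delta.
Qed.

(** Expresses the trace against a square as a sum of values of the form of [A], so that form
    inequalities pass to traces. *)
Lemma retr_sandwich n (A L : 'M[C]_n) : L^t* = L ->
  retr (L *m L *m A) = \sum_i qform A (L *m delta_mx i 0).
Proof.
move=> hL; rewrite /retr -mulmxA mxtrace_mulC -/(retr _) retrE.
by apply: eq_bigr => i _; rewrite -qform_conj hL.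
Qed.

Lemma mxfun_comp n (A : 'M[C]_n) (phi psi : R -> R) : A^t* = A ->
  mxfun phi (mxfun psi A) = mxfun (phi \o psi) A.
Proof.
move=> /spectral_decomposition[P [d [P1 P2 AE fA]]].
by rewrite [in RHS]fA (mxfun_rdiag phi P1 (fA psi)).
Qed.

Lemma retr_unitary n (A P : 'M[C]_n) : P^t* *m P = 1%:M ->
  retr A = \sum_i qform A (P^t* *m delta_mx i 0).
Proof.
move=> P1; have <- : retr (P *m A *m P^t*) = retr A.
  by rewrite /retr mxtrace_mulC mulmxA P1 mul1mx.
rewrite retrE; apply: eq_bigr => i _.
by rewrite -qform_conj trmxCK.
Qed.

Lemma qform_eigenvector n (P : 'M[C]_n) (d : 'I_n -> R) i : P *m P^t* = 1%:M ->
  qform (P^t* *m rdiag d *m P) (P^t* *m delta_mx i 0) = d i.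
Proof.
move=> P2; rewrite qform_conj mulmxA P2 mul1mx qform_rdiag.
rewrite (bigD1 i) //= big1 => [|j ji].
  by rewrite mxE !eqxx normsq1 mulr1 addr0.
by rewrite mxE (negbTE ji) normsq0 mulr0.
Qed.

Lemma qform1_eigenvector n (P : 'M[C]_n) i : P^t* *m P = 1%:M ->
  qform 1%:M (P^t* *m delta_mx i 0) = 1.
Proof.
move=> P1; have P2 := mulmx1C P1.
by have := qform_eigenvector (fun=> 1) i P2; rewrite rdiag1 mulmx1 P1.
Qed.

(** The squared coordinates of [v] in an eigenbasis of [A] are probability weights, against which
    the scalar inequality is averaged. Taking [psi] the identity gives Jensen's inequality, taking
    it the inverse gives Klein's. *)
Lemma qform_mxfun_affine n (A : 'M[C]_n) v (a b : R) (phi psi : R -> R) :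
  posdef A -> qform 1%:M v = 1 ->
  (forall x, 0 < x -> a + b * psi x <= phi x) ->
  a + b * qform (mxfun psi A) v <= qform (mxfun phi A) v.
Proof.
move=> /posdef_spectral[P [d [P1 P2 AE fA d0]]] v1 abphi.
have {}v1 : \sum_i normsq ((P *m v) i 0) = 1.
  rewrite -v1 -P1 -[X in X *m P]mulmx1 -rdiag1 qform_conj qform_rdiag.
  by apply: eq_bigr => i _; rewrite mul1r.
rewrite 2!fA 2!qform_conj 2!qform_rdiag.
rewrite -[X in X + _]mulr1 -v1 2!mulr_sumr -big_split /=.
apply: ler_sum => i _; rewrite mulrA -mulrDl ler_wpM2r ?normsq_ge0 //.
exact: abphi.
Qed.

(* Peierls' argument: evaluate both sides in an eigenbasis of [A0]. *)
Lemma retr_mxfun_convex n (k : R -> R) (t : R) (A0 A1 A2 : 'M[C]_n) :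
  0 < t < 1 -> posdef A0 -> posdef A1 -> posdef A2 ->
  (forall x y, 0 < x -> x <= y -> k y <= k x) -> convex_pos k ->
  (forall v, t * qform A1 v + (1 - t) * qform A2 v <= qform A0 v) ->
  retr (mxfun k A0) <= t * retr (mxfun k A1) + (1 - t) * retr (mxfun k A2).
Proof.
move=> /andP[t0 t1] p0 p1 p2 kdec kconv A012.
have [P [d [P1 P2 AE fA d0]]] := posdef_spectral p0.
have t1' : 0 < 1 - t by rewrite subr_gt0.
rewrite 3!(retr_unitary _ P1) 2!mulr_sumr -big_split /=.
apply: ler_sum => i _; rewrite fA (qform_eigenvector _ _ P2) /=.
have v1 := qform1_eigenvector i P1.
have := A012 (P^t* *m delta_mx i 0).
rewrite [in leRHS]AE (qform_eigenvector _ _ P2).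
move: (P^t* *m delta_mx i 0) v1 => v v1 dv.
have v0 : v != 0.
  apply/eqP => v0; move: v1; rewrite v0 /qform mulmx0 mxE => /esym/eqP.
  by rewrite oner_eq0.
have [_ /(_ v v0) q1] := (posdefP A1).1 p1.
have [_ /(_ v v0) q2] := (posdefP A2).1 p2.
have s0 : 0 < t * qform A1 v + (1 - t) * qform A2 v.
  by apply: addr_gt0; apply: mulr_gt0.
have [p kp] := convex_supporting_line kconv s0.
set s := t * _ + _ in dv s0 kp.
have kA B : posdef B -> k s + p * (qform B v - s) <= qform (mxfun k B) v.
  move=> pB; have kp' x : 0 < x -> k s - p * s + p * id x <= k x.
    by move=> /kp; rewrite mulrBr addrA addrAC.
  have := qform_mxfun_affine pB v1 kp'; rewrite (mxfun_id (posdef_adj pB)).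
  by rewrite mulrBr addrA addrAC.
apply: le_trans (kdec _ _ s0 dv) _.
(* The linear terms cancel because [s] is the weighted mean of the two form values. *)
have <- : t * (k s + p * (qform A1 v - s))
    + (1 - t) * (k s + p * (qform A2 v - s)) = k s.
  by rewrite /s; move: (qform A1 v) (qform A2 v) => a b; ring.
by apply: lerD; rewrite ler_pM2l //; exact: kA.
Qed.

(* Klein's inequality for a pair of functions related by Legendre duality,
   evaluated in an eigenbasis of [T]. *)
Lemma retr_mxfun_dual n (phi psi : R -> R) (T Z : 'M[C]_n) :
  posdef T -> posdef Z ->
  (forall t x, 0 < t -> 0 < x -> phi t <= psi x + t / x) ->
  retr (mxfun phi T) <= retr (mxfun psi Z) + retr (T *m invmx Z).
Proof.
move=> pT pZ phipsi.
have [P [d [P1 P2 TE fT d0]]] := posdef_spectral pT.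
have -> : retr (T *m invmx Z)
    = \sum_i d i * qform (invmx Z) (P^t* *m delta_mx i 0).
  rewrite /retr TE -!mulmxA mxtrace_mulC -!mulmxA (mulmxA P) /mxtrace raddf_sum.
  apply: eq_bigr => i _.
  by rewrite -qform_conj trmxCK qform_delta mul_diag_mx mxE mxE [LHS]ReZ.
rewrite 2!(retr_unitary _ P1) -big_split /=; apply: ler_sum => i _.
rewrite fT (qform_eigenvector _ _ P2) /=.
(* The duality hypothesis at the eigenvalue [d i] is affine in [x^-1]. *)
have := @qform_mxfun_affine _ Z _ (phi (d i)) (- d i) psi (fun x => x^-1) pZ
  (qform1_eigenvector i P1).
rewrite (mxfun_inv pZ) mulNr lerBlDr; apply=> x x0.
by rewrite mulNr lerBlDr phipsi.
Qed.

Lemma retr_mulmx_concave n (t : R) (W M0 M1 M2 : 'M[C]_n) : posdef W ->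
  (forall v, t * qform M1 v + (1 - t) * qform M2 v <= qform M0 v) ->
  t * retr (W *m M1) + (1 - t) * retr (W *m M2) <= retr (W *m M0).
Proof.
move=> pW M012; rewrite -(mxfun_sqrtK pW).
have hL := posdef_adj (posdef_sqrt pW).
rewrite 3!(retr_sandwich _ hL) 2!mulr_sumr -big_split /=.
by apply: ler_sum => i _; exact: M012.
Qed.
End TraceFunctionals.

(** * The variational formula for the trace of [h] *)

Section VariationalFormula.
Local Open Scope sesquilinear_scope.
Context {R : realType}.
Local Notation C := R[i].

Lemma invmx_uniq n (A B : 'M[C]_n) : A *m B = 1%:M -> invmx A = B.
Proof.
move=> AB; have [uA _] := mulmx1_unit AB.
by rewrite -[LHS]mulmx1 -AB (mulKmx uA).
Qed.

Lemma posdef_sandwich n (S A : 'M[C]_n) :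
  posdef S -> posdef A -> posdef (S *m A *m S).
Proof. by move=> pS pA; rewrite -{1}(posdef_adj pS); exact: posdef_conj pS.2 pA. Qed.

Lemma invmx_sandwich n (S A : 'M[C]_n) : posdef S -> posdef A ->
  invmx (S *m A *m S) = invmx S *m invmx A *m invmx S.
Proof.
move=> pS pA; apply: invmx_uniq.
by rewrite -!mulmxA (mulKVmx pS.2) (mulKVmx pA.2) (mulmxV pS.2).
Qed.

(** With [S] and [V] the square roots of [X] and [W^-1], the inverse of [S W S] is
    [(S^-1 V) (V S^-1)], and [V X^-1 V] is the same product in the other order. This exposes [X^-1],
    where concavity is available. *)
Lemma retr_mxfun_sandwich n (X W : 'M[C]_n) (phi : R -> R) :
  posdef X -> posdef W ->
  retr (mxfun phi (mxfun Num.sqrt X *m W *m mxfun Num.sqrt X))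
    = retr (mxfun (fun s => phi s^-1)
        (mxfun Num.sqrt (invmx W) *m invmx X *m mxfun Num.sqrt (invmx W))).
Proof.
move=> pX pW; have pS := posdef_sqrt pX; have SS := mxfun_sqrtK pX.
have pV := posdef_sqrt (posdef_inv pW); have VV := mxfun_sqrtK (posdef_inv pW).
move: (mxfun Num.sqrt X) (mxfun Num.sqrt (invmx W)) pS SS pV VV.
move=> S V pS SS pV VV.
have pT := posdef_sandwich pS pW; have pTi := posdef_inv pT.
have -> : mxfun phi (S *m W *m S) = mxfun (fun s => phi s^-1) (invmx (S *m W *m S)).
  rewrite -(mxfun_inv pT) (mxfun_comp _ _ (posdef_adj pT)).
  by apply: eq_mxfun pT => x _ /=; rewrite invrK.
have pC := posdef_sandwich pV (posdef_inv pX).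
have uQ : invmx S *m V \in unitmx by rewrite unitmx_mul unitmx_inv pS.2 pV.2.
rewrite /retr; apply: (congr1 (@complex.Re R)).
apply: (tr_mxfun_similar _ (posdef_adj pTi) (posdef_adj pC) uQ).
have -> : invmx X = invmx S *m invmx S.
  apply: invmx_uniq; rewrite -SS -!mulmxA (mulKVmx pS.2); exact: mulmxV pS.2.
by rewrite (invmx_sandwich pS pW) -VV !mulmxA.
Qed.

Lemma retr_sandwich_inv n (S W Y : 'M[C]_n) : posdef S -> posdef Y ->
  retr (S *m W *m S *m invmx (S *m Y *m S)) = retr (W *m invmx Y).
Proof.
move=> pS pY; rewrite (invmx_sandwich pS pY) -!mulmxA (mulKVmx pS.2).
by rewrite /retr mxtrace_mulC -!mulmxA (mulVmx pS.2) mulmx1.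
Qed.

(* [W] realises the Legendre supremum for [Z = S Y S] in an eigenbasis of [Z],
   up to [e] for each eigenvalue. *)
Lemma retr_mxfun_dual_approx n (h b : R -> R) (S Y : 'M[C]_n) (e : R) :
  posdef S -> posdef Y ->
  (forall x, 0 < x -> exists2 t, 0 < t & h x <= b t - t / x + e) ->
  exists2 W : 'M[C]_n, posdef W &
    retr (mxfun h (S *m Y *m S))
      <= retr (mxfun b (S *m W *m S)) - retr (W *m invmx Y) + n%:R * e.
Proof.
move=> pS pY hb; have pZ := posdef_sandwich pS pY.
have [P [d [P1 P2 ZE fZ d0]]] := posdef_spectral pZ.
have /choice[s sP] : forall i, exists t, 0 < t /\ h (d i) <= b t - t / d i + e.
  by move=> i; have [t t0 ht] := hb _ (d0 i); exists t.
have Pu : P \in unitmx by case: (mulmx1_unit P2).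
have pT : posdef (P^t* *m rdiag s *m P).
  by apply: posdef_conj Pu _; apply: posdef_rdiag => i; case: (sP i).
have bT := mxfun_rdiag b P1 (erefl (P^t* *m rdiag s *m P)).
have TZ : P^t* *m rdiag s *m P *m (P^t* *m rdiag ((fun x => x^-1) \o d) *m P)
    = P^t* *m rdiag (fun i => s i / d i) *m P.
  by rewrite -!mulmxA (mulmxA P) P2 mul1mx (mulmxA (rdiag _)) rdiagM.
move: (P^t* *m rdiag s *m P) pT bT TZ => T pT bT TZ.
have TE : T = S *m (invmx S *m T *m invmx S) *m S.
  by rewrite -!mulmxA (mulVmx pS.2) mulmx1 (mulKVmx pS.2).
(* Chosen so that [S W S = T], which shares the eigenbasis of [Z] and has the near-optimal
   eigenvalues [s i]. *)
exists (invmx S *m T *m invmx S).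
  exact: posdef_sandwich (posdef_inv pS) pT.
rewrite -(retr_sandwich_inv _ pS pY) -TE fZ.
rewrite bT -(mxfun_inv pZ) fZ TZ.
have trd (c : 'I_n -> R) : retr (P^t* *m rdiag c *m P) = \sum_i c i.
  rewrite (retr_unitary _ P1); apply: eq_bigr => i _.
  exact: qform_eigenvector.
rewrite 3!trd -sumrB.
have -> : n%:R * e = \sum_(i < n) e.
  by rewrite sumr_const card_ord; exact: mulr_natl.
rewrite -big_split /=; apply: ler_sum => i _; exact: (sP i).2.
Qed.
End VariationalFormula.

(** * Joint convexity of the trace function *)

Section JointConvexity.
Context {R : realType}.
Local Notation C := R[i].

Lemma concave_tilde_convex_pos (h : R -> R) :
  concave_function [set x : R | 0 < x] (tilde h) ->
  convex_pos (fun x => h x^-1).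
Proof.
move=> hc x y t x0 y0 /andP[t0 t1].
have := hc (Itv01 t0 t1) x y (mem_set x0) (mem_set y0).
by rewrite /tilde !opprK !convRE.
Qed.

Definition sandwich_trace (h : R -> R) (k : nat) (X Y : 'M[C]_k) : R :=
  retr (mxfun h (mxfun Num.sqrt X *m Y *m mxfun Num.sqrt X)).

(** A matrix [W] nearly optimal for the pair [X0], [Y0] is used unchanged for the other two pairs,
    where every [W] gives a lower bound. *)
Lemma sandwich_trace_inverse_convex (h : R -> R) (k : nat) (t : R)
    (X0 X1 X2 Y0 Y1 Y2 : 'M[C]_k) :
  (forall x y : R, 0 < x -> x <= y -> h x <= h y) ->
  convex_pos (fun x => h x^-1) ->
  h x * x @[x --> 0^'+] --> (0 : R) ->
  (forall x y : R, 0 < x -> 0 < y ->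
    breve h (2 / (x^-1 + y^-1)) <= (breve h x + breve h y) / 2) ->
  0 < t < 1 ->
  posdef X0 -> posdef X1 -> posdef X2 -> posdef Y0 -> posdef Y1 -> posdef Y2 ->
  (forall v, t * qform (invmx X1) v + (1 - t) * qform (invmx X2) v
    <= qform (invmx X0) v) ->
  (forall v, t * qform (invmx Y1) v + (1 - t) * qform (invmx Y2) v
    <= qform (invmx Y0) v) ->
  sandwich_trace h X0 Y0
    <= t * sandwich_trace h X1 Y1 + (1 - t) * sandwich_trace h X2 Y2.
Proof.
move=> h_mono h_conv h_lim h_harm t01 pX0 pX1 pX2 pY0 pY1 pY2 X012 Y012.
have /andP[t0 t1] := t01; have t1' : 0 < 1 - t by rewrite subr_gt0.
pose kappa s := breve h s^-1.
have kdec x y : 0 < x -> x <= y -> kappa y <= kappa x.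
  move=> x0 xy; have y0 := lt_le_trans x0 xy.
  by apply: breve_mono; rewrite ?invr_gt0 // lef_pV2.
(* The harmonic-mean hypothesis at [x^-1] and [y^-1] is midpoint convexity of [kappa]. *)
have kmid x y : 0 < x -> 0 < y ->
    kappa ((x + y) / 2) <= (kappa x + kappa y) / 2.
  move=> x0 y0; have xi : 0 < x^-1 by rewrite invr_gt0.
  have yi : 0 < y^-1 by rewrite invr_gt0.
  by have := h_harm _ _ xi yi; rewrite !invrK -[2 / _]invf_div.
have kconv := midpoint_convex_nonincreasing kdec kmid.
apply/ler_addgt0Pr => e e0.
have combine (F0 F1 F2 T0 T1 T2 w0 w1 w2 d : R) :
    F0 <= T0 - w0 + d -> T0 <= T1 + T2 -> w1 + w2 <= w0 ->
    T1 <= F1 + w1 -> T2 <= F2 + w2 -> d <= e -> F0 <= F1 + F2 + e.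
  by clear; lra.
(* An error per eigenvalue whose sum over the [k] eigenvalues is at most [e]; adding [1] covers
   [k = 0]. *)
have e0' : 0 < e / (k%:R + 1) by rewrite divr_gt0 // ltr_wpDl ?ler0n.
have hb x : 0 < x ->
    exists2 s, 0 < s & h x <= breve h s - s / x + e / (k%:R + 1).
  move=> x0; have xi : 0 < x^-1 by rewrite invr_gt0.
  by have := breve_duality h_mono h_conv xi e0'; rewrite invrK.
have [W pW] := retr_mxfun_dual_approx (posdef_sqrt pX0) pY0 hb.
have ke : k%:R * (e / (k%:R + 1)) <= e.
  rewrite mulrCA ler_piMr ?(ltW e0) // ler_pdivrMr ?ltr_wpDl ?ler0n //.
  by rewrite mul1r lerDl.
rewrite -/(sandwich_trace h X0 Y0) => W0.
have pV := posdef_sqrt (posdef_inv pW).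
pose D X := mxfun Num.sqrt (invmx W) *m invmx X *m mxfun Num.sqrt (invmx W).
have pD X : posdef X -> posdef (D X).
  by move=> pX; apply: (posdef_sandwich pV); exact: posdef_inv.
have duality X Y : posdef X -> posdef Y ->
    retr (mxfun kappa (D X)) <= sandwich_trace h X Y + retr (W *m invmx Y).
  move=> pX pY; have pS := posdef_sqrt pX.
  rewrite -(retr_mxfun_sandwich (breve h) pX pW) -(retr_sandwich_inv W pS pY).
  apply: (retr_mxfun_dual (posdef_sandwich pS pW) (posdef_sandwich pS pY)).
  move=> s x s0 x0; have xi : 0 < x^-1 by rewrite invr_gt0.
  by have := breve_le h_mono h_lim s0 xi; rewrite invrK addrC.
have qD X v : qform (D X) v
    = qform (invmx X) (mxfun Num.sqrt (invmx W) *m v).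
  by rewrite -qform_conj (posdef_adj pV).
have D012 v : t * qform (D X1) v + (1 - t) * qform (D X2) v <= qform (D X0) v.
  by rewrite 3!qD; exact: X012.
have k012 := retr_mxfun_convex t01 (pD _ pX0) (pD _ pX1) (pD _ pX2)
  kdec kconv D012.
have y012 := retr_mulmx_concave pW Y012.
rewrite (retr_mxfun_sandwich (breve h) pX0 pW) -/(D X0) in W0.
have d1 := duality _ _ pX1 pY1; have d2 := duality _ _ pX2 pY2.
have {}d1 := ler_wpM2l (ltW t0) d1; have {}d2 := ler_wpM2l (ltW t1') d2.
rewrite !mulrDr in d1 d2.
exact: (combine _ _ _ _ _ _ _ _ _ _ W0 k012 y012 d1 d2 ke).
Qed.

Lemma trace_function_convex_interior (h f g : R -> R) (m n k : nat)
    (Phi : {linear 'M[C]_m -> 'M[C]_k}) (Psi : {linear 'M[C]_n -> 'M[C]_k})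
    (A1 A2 : 'M[C]_m) (B1 B2 : 'M[C]_n) (t : R) :
  (forall x y : R, 0 < x -> x <= y -> h x <= h y) ->
  convex_pos (fun x => h x^-1) ->
  h x * x @[x --> 0^'+] --> (0 : R) ->
  (forall x y : R, 0 < x -> 0 < y ->
    breve h (2 / (x^-1 + y^-1)) <= (breve h x + breve h y) / 2) ->
  (forall x, 0 < x -> 0 < f x) -> (forall x, 0 < x -> 0 < g x) ->
  operator_monotone_decreasing f -> operator_monotone_decreasing g ->
  strictly_positive Phi -> strictly_positive Psi ->
  posdef A1 -> posdef A2 -> posdef B1 -> posdef B2 -> 0 < t < 1 ->
  trace_function h f g Phi Psi (t%:C *: A1 + (1 - t)%:C *: A2)
      (t%:C *: B1 + (1 - t)%:C *: B2)
    <= t * trace_function h f g Phi Psi A1 B1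
       + (1 - t) * trace_function h f g Phi Psi A2 B2.
Proof.
move=> h_mono h_conv h_lim h_harm f0 g0 fmd gmd Phi_pos Psi_pos.
move=> pA1 pA2 pB1 pB2 t01; have /andP[t0 t1] := t01.
have t1' : 0 < 1 - t by rewrite subr_gt0.
have pcomb p (M N : 'M[C]_p) : posdef M -> posdef N ->
    posdef (t%:C *: M + (1 - t)%:C *: N).
  by move=> pM pN; apply: posdefD (posdefZ t0 pM) _; exact: (posdefZ t1' pN).1.
have X012 := strengthened_convexity t01 f0 fmd Phi_pos pA1 pA2.
have Y012 := strengthened_convexity t01 g0 gmd Psi_pos pB1 pB2.
have pX1 := Phi_pos _ (posdef_mxfun f0 pA1).
have pX2 := Phi_pos _ (posdef_mxfun f0 pA2).
have pX0 := Phi_pos _ (posdef_mxfun f0 (pcomb _ _ _ pA1 pA2)).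
have pY1 := Psi_pos _ (posdef_mxfun g0 pB1).
have pY2 := Psi_pos _ (posdef_mxfun g0 pB2).
have pY0 := Psi_pos _ (posdef_mxfun g0 (pcomb _ _ _ pB1 pB2)).
exact: (sandwich_trace_inverse_convex h_mono h_conv h_lim h_harm t01
  pX0 pX1 pX2 pY0 pY1 pY2 X012 Y012).
Qed.
End JointConvexity.

Theorem theorem3p3 (R : realType) (h f g : R -> R) (m n k : nat)
    (Phi : {linear 'M[R[i]]_m -> 'M[R[i]]_k})
    (Psi : {linear 'M[R[i]]_n -> 'M[R[i]]_k})
    (h_mono : forall x y : R, 0 < x -> x <= y -> h x <= h y)
    (h_concave : concave_function [set x : R | 0 < x] (tilde h))
    (h_lim : h x * x @[x --> 0^'+] --> (0 : R))
    (h_breve : forall x y : R, 0 < x -> 0 < y ->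
      (breve h x + breve h y) / 2 <= breve h ((x + y) / 2) /\
      breve h (2 / (x^-1 + y^-1)) <= (breve h x + breve h y) / 2)
    (f_pos : forall x : R, 0 < x -> 0 < f x)
    (g_pos : forall x : R, 0 < x -> 0 < g x)
    (f_omd : operator_monotone_decreasing f)
    (g_omd : operator_monotone_decreasing g)
    (Phi_pos : strictly_positive Phi)
    (Psi_pos : strictly_positive Psi) :
  jointly_convex (trace_function h f g Phi Psi).
Proof.
move=> A1 A2 B1 B2 t pA1 pA2 pB1 pB2 /andP[t0 t1].
(* The endpoints are settled directly, as the parallel-sum argument divides by [t] and [1 - t]. *)
have [->|t0'] := eqVneq t 0.
  by rewrite subr0 rmorph0 rmorph1 !scale0r !scale1r !add0r mul0r mul1r add0r.
have [->|t1'] := eqVneq t 1.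
  by rewrite subrr rmorph0 rmorph1 !scale0r !scale1r !addr0 mul0r mul1r addr0.
have t01 : 0 < t < 1 by rewrite !lt_neqAle eq_sym t0' t0 t1' t1.
have h_harm x y (x0 : 0 < x) (y0 : 0 < y) := (h_breve x y x0 y0).2.
exact: (trace_function_convex_interior h_mono (concave_tilde_convex_pos h_concave)
  h_lim h_harm f_pos g_pos f_omd g_omd Phi_pos Psi_pos pA1 pA2 pB1 pB2 t01).
Qed.
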